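(* Let $M\in\mathbb{R}^{n\times n}$ be a symmetric positive semidefinite matrix with $\mu I\preceq M\preceq\lambda I$, where $0<\mu\le\lambda$. For any $\epsilon\in(0,1)$ (and any failure probability $\delta\in(0,1)$) there is an $\epsilon$-approximate square-root solver for $M$ that runs in time $$\tilde{O}(\mathrm{nnz}(M)+\mathcal{T}),$$ where $\mathcal{T}$ is the running time for solving $(M+\kappa I)x=v$ for arbitrary $v\in\mathbb{R}^n$ and $\kappa\in[\tilde\Omega(\mu),\tilde O(\lambda)]$.
   Context: $\mathrm{nnz}(M)$ is the number of nonzero entries of $M$. Norms are $\ell_2$ norms. $\epsilon$-approximate square-root solver: a randomized algorithm which, given any $v\in\mathbb{R}^n$, with probability at least $1-\delta$ returns $x$ with $\|x-M^{1/2}v\|\le\epsilon\|M^{1/2}v\|$. ''Solving $(M+\kappa I)x=v$'' means: for prescribed $\epsilon',\delta'\in(0,1)$, returning with probability at least $1-\delta'$ a vector $\tilde x$ with $\|\tilde x-(M+\kappa I)^{-1}v\|\le\epsilon'\|v\|$; the running time $\mathcal{T}$ of this solver is counted up to factors polylogarithmic in $1/\epsilon'$ and $1/\delta'$. $\tilde O,\tilde\Omega$ hide factors polylogarithmic in the input parameters ($\lambda/\mu$, the size of $v$), the error rate $\epsilon$ and the failure probability $\delta$. Running time counts arithmetic operations in exact arithmetic (numerical constants depending only on $\lambda,\mu,\epsilon$ may be precomputed). *)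

(* Defs.v *)
From HB Require Import structures.
From mathcomp Require Import all_boot all_order all_algebra.
From mathcomp Require Import all_classical all_reals all_analysis.

Set Implicit Arguments.
Unset Strict Implicit.
Unset Printing Implicit Defensive.

Import Order.TTheory GRing.Theory Num.Theory.

Local Open Scope classical_set_scope.
Local Open Scope ring_scope.

Section LinearAlgebra.
Context {R : realType} {n : nat}.
Implicit Types (v : 'cV[R]_n) (A B M : 'M[R]_n).

(* The norm that MathComp-Analysis puts on matrices is the sup norm. *)
Definition l2norm v : R := Num.sqrt (\sum_(i < n) v i 0 ^+ 2).

Definition quad_form A v : R := (v^T *m A *m v) 0 0.

Definition symmetric_mx A : Prop := A^T = A.

Definition psd_mx A : Prop := symmetric_mx A /\ forall v, 0 <= quad_form A v.

Definition loewner_le A B : Prop := forall v, quad_form A v <= quad_form B v.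

(* The positive semidefinite square root of a positive semidefinite M. *)
Definition sqrtmx M : 'M[R]_n := xget 0 [set S | psd_mx S /\ S *m S = M].

(* Row-major list of the positions of the nonzero entries. *)
Definition support_mx M : seq ('I_n * 'I_n) :=
  [seq ij <- enum {: 'I_n * 'I_n} | M ij.1 ij.2 != 0].

Definition nnz M : nat := #|[set ij : 'I_n * 'I_n | M ij.1 ij.2 != 0%R]%SET|.

End LinearAlgebra.

(* P A >= p for an event A; A itself need not be measurable, in which case P is
   understood as the inner measure. *)
Definition with_prob_ge {R : realType} {d : measure_display}
    {T : measurableType d} (P : probability T R) (p : R) (A : set T) : Prop :=
  exists E : set T, [/\ measurable E, E `<=` A & (p%:E <= P E)%E].

(* A real RAM, presented as a structured language.  A memory has integer and
   real variables and integer and real arrays, all named by numerals of the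
   program; only integers serve as array indices, and there is no conversion
   between reals and integers.  Integer arithmetic is limited to addition and
   truncated subtraction. *)
Section Machine.
Context {R : realType}.

Inductive iexp :=
| IConst of nat
| IVar of nat
| IGet of nat & iexp
| IAdd of iexp & iexp
| ISub of iexp & iexp.

Inductive rexp :=
| RConst of R
| RVar of nat
| RGet of nat & iexp
| RAdd of rexp & rexp
| RSub of rexp & rexp
| RMul of rexp & rexp
| RDiv of rexp & rexp.

Inductive test :=
| ILt of iexp & iexp
| RLe of rexp & rexp.

(* Flip x tosses a fair coin and puts the outcome in the integer variable x;
   Solve kappa eps delta src dst hands the vector stored in the real array src
   to the linear system solver and stores the answer in the real array dst. *)
Inductive cmd :=
| Skip
| ISet of nat & iexp
| IPut of nat & iexp & iexp
| RSet of nat & rexp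
| RPut of nat & iexp & rexp
| Seq of cmd & cmd
| If of test & cmd & cmd
| While of test & cmd
| Flip of nat
| Solve of rexp & rexp & rexp & nat & nat.

(* draws is the number of random draws made so far (coins and solver calls). *)
Record state := State {
  ivar : nat -> nat;
  iarr : nat -> nat -> nat;
  rvar : nat -> R;
  rarr : nat -> nat -> R;
  draws : nat;
  clock : R }.

Definition upd {T : Type} (f : nat -> T) (x : nat) (y : T) : nat -> T :=
  fun z => if z == x then y else f z.

Fixpoint ieval (s : state) (e : iexp) : nat :=
  match e with
  | IConst k => k
  | IVar x => ivar s x
  | IGet a e1 => iarr s a (ieval s e1)
  | IAdd e1 e2 => (ieval s e1 + ieval s e2)%N
  | ISub e1 e2 => (ieval s e1 - ieval s e2)%N
  end.

Fixpoint reval (s : state) (e : rexp) : R :=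
  match e with
  | RConst c => c
  | RVar x => rvar s x
  | RGet a i => rarr s a (ieval s i)
  | RAdd e1 e2 => reval s e1 + reval s e2
  | RSub e1 e2 => reval s e1 - reval s e2
  | RMul e1 e2 => reval s e1 * reval s e2
  | RDiv e1 e2 => reval s e1 / reval s e2
  end.

Definition teval (s : state) (t : test) : bool :=
  match t with
  | ILt e1 e2 => (ieval s e1 < ieval s e2)%N
  | RLe e1 e2 => reval s e1 <= reval s e2
  end.

Fixpoint icost (e : iexp) : nat :=
  match e with
  | IConst _ | IVar _ => 1
  | IGet _ e1 => (icost e1).+1
  | IAdd e1 e2 | ISub e1 e2 => (icost e1 + icost e2).+1
  end.

Fixpoint rcost (e : rexp) : nat :=
  match e with
  | RConst _ | RVar _ => 1
  | RGet _ i => (icost i).+1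
  | RAdd e1 e2 | RSub e1 e2 | RMul e1 e2 | RDiv e1 e2 =>
      (rcost e1 + rcost e2).+1
  end.

Definition tcost (t : test) : nat :=
  match t with
  | ILt e1 e2 => (icost e1 + icost e2).+1
  | RLe e1 e2 => (rcost e1 + rcost e2).+1
  end.

Definition tick (s : state) (t : R) : state :=
  State (ivar s) (iarr s) (rvar s) (rarr s) (draws s) (clock s + t).
Definition set_ivar (s : state) x k :=
  State (upd (ivar s) x k) (iarr s) (rvar s) (rarr s) (draws s) (clock s).
Definition set_iarr (s : state) a i k :=
  State (ivar s) (upd (iarr s) a (upd (iarr s a) i k)) (rvar s) (rarr s)
        (draws s) (clock s).
Definition set_rvar (s : state) x r :=
  State (ivar s) (iarr s) (upd (rvar s) x r) (rarr s) (draws s) (clock s).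
Definition set_rarr (s : state) a i r :=
  State (ivar s) (iarr s) (rvar s) (upd (rarr s) a (upd (rarr s a) i r))
        (draws s) (clock s).
Definition next_draw (s : state) :=
  State (ivar s) (iarr s) (rvar s) (rarr s) (draws s).+1 (clock s).

Definition read_vec (n : nat) (s : state) (a : nat) : 'cV[R]_n :=
  \col_i rarr s a i.
Definition array_of_vec (n : nat) (v : 'cV[R]_n) : nat -> R :=
  fun i => if insub i is Some j then v j 0 else 0.
Definition write_vec (n : nat) (s : state) (a : nat) (v : 'cV[R]_n) :=
  State (ivar s) (iarr s) (rvar s) (upd (rarr s) a (array_of_vec v))
        (draws s) (clock s).

(* answer w kappa eps delta v is what a randomized solver returns on the random
   seed w when asked for (M + kappa I)^-1 v up to accuracy eps and failure
   probability delta, and duration is the time it takes to do so. *)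
Record solver (n : nat) (Omega : Type) := Solver {
  answer : Omega -> R -> R -> R -> 'cV[R]_n -> 'cV[R]_n;
  duration : Omega -> R -> R -> R -> 'cV[R]_n -> R }.

Section Execution.
Context {n : nat} {Omega : Type}.
Context (S : solver n Omega) (seed : nat -> Omega) (coin : nat -> bool).

(* Each node of an expression or test costs one unit of time, and so does each
   elementary command.  The j-th random draw consumes coin j or seed j; thus
   every call of the solver uses a fresh seed.  A call is charged its duration
   plus n units for transmitting the vectors. *)
Inductive exec : cmd -> state -> state -> Prop :=
| ExecSkip s : exec Skip s s
| ExecISet s x e :
    exec (ISet x e) s (tick (set_ivar s x (ieval s e)) (icost e).+1%:R)
| ExecIPut s a i e :
    exec (IPut a i e) s
      (tick (set_iarr s a (ieval s i) (ieval s e)) (icost i + icost e).+1%:R)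
| ExecRSet s x e :
    exec (RSet x e) s (tick (set_rvar s x (reval s e)) (rcost e).+1%:R)
| ExecRPut s a i e :
    exec (RPut a i e) s
      (tick (set_rarr s a (ieval s i) (reval s e)) (icost i + rcost e).+1%:R)
| ExecSeq c1 c2 s1 s2 s3 :
    exec c1 s1 s2 -> exec c2 s2 s3 -> exec (Seq c1 c2) s1 s3
| ExecIf t c1 c2 s1 s2 :
    exec (if teval s1 t then c1 else c2) (tick s1 (tcost t)%:R) s2 ->
    exec (If t c1 c2) s1 s2
| ExecWhileStop t c s :
    ~~ teval s t -> exec (While t c) s (tick s (tcost t)%:R)
| ExecWhileStep t c s1 s2 s3 :
    teval s1 t -> exec c (tick s1 (tcost t)%:R) s2 ->
    exec (While t c) s2 s3 -> exec (While t c) s1 s3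
| ExecFlip s x :
    exec (Flip x) s (tick (next_draw (set_ivar s x (coin (draws s)))) 1)
| ExecSolve s ek ee ed src dst :
    let w := seed (draws s) in
    let kappa := reval s ek in
    let eps := reval s ee in
    let delta := reval s ed in
    let v := read_vec n s src in
    exec (Solve ek ee ed src dst) s
      (tick (next_draw (write_vec s dst (answer S w kappa eps delta v)))
            ((rcost ek + rcost ee + rcost ed + n).+1%:R
             + duration S w kappa eps delta v)).

End Execution.

(* Input conventions: n, nnz M and the length of the table of precomputed
   constants are in the integer variables 0, 1, 2 and delta is in the real
   variable 0.  M is given as the list of its nonzero entries: row indices,
   column indices and values are in the integer arrays 0 and 1 and the real
   array 1.  The vector v and the table are in the real arrays 0 and 2.
   Everything else is 0. *)
Definition init_state (n : nat) (M : 'M[R]_n) (v : 'cV[R]_n) (delta : R)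
    (table : seq R) : state :=
  let rows := [seq nat_of_ord ij.1 | ij <- support_mx M] in
  let cols := [seq nat_of_ord ij.2 | ij <- support_mx M] in
  let vals := [seq M ij.1 ij.2 | ij <- support_mx M] in
  State
    (nth 0%N [:: n; nnz M; size table])
    (fun a => nth 0%N (nth [::] [:: rows; cols] a))
    (nth 0 [:: delta])
    (fun a => if a == 0%N then array_of_vec v
              else nth 0 (nth [::] [:: [::]; vals; table] a))
    0 0.

(* The output is left in the real array 3. *)
Definition halts_with (n : nat) (Omega : Type) (S : solver n Omega)
    (seed : nat -> Omega) (coin : nat -> bool) (p : cmd) (s0 : state)
    (x : 'cV[R]_n) (t : R) : Prop :=
  exists s, [/\ exec S seed coin p s0 s, read_vec n s 3 = x & clock s = t].

End Machine.

Arguments rexp : clear implicits.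
Arguments test : clear implicits.
Arguments cmd : clear implicits.
Arguments state : clear implicits.
Arguments solver : clear implicits.

Section Randomness.
Context {R : realType}.

(* The seeds have law Q, the coins are fair, and all of them are independent.
   Both the laws and the independence of subfamilies follow by taking some of
   the A i and B i to be the full set. *)
Definition random_tape {d d' : measure_display} {Omega : measurableType d}
    {W : measurableType d'} (Q : probability Omega R) (P : probability W R)
    (seed : nat -> W -> Omega) (coin : nat -> W -> bool) : Prop :=
  [/\ forall i, measurable_fun setT (seed i),
      forall i, measurable_fun setT (coin i) &
      forall (m : nat) (A : nat -> set Omega) (B : nat -> set bool),
        (forall i, measurable (A i)) ->
        P (\bigcap_(i in [set j | (j < m)%N])
             (seed i @^-1` A i `&` coin i @^-1` B i)) =
        (\big[*%E/1%E]_(i < m) (Q (A i) * bernoulli_prob (2^-1 : R) (B i)))%E].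

(* S solves (M + kappa I) x = v for all v and all kappa in [klo, khi], in time
   T up to a polylogarithmic factor in 1/eps and 1/delta of degree a. *)
Definition solves_shifted {n : nat} {d : measure_display}
    {Omega : measurableType d} (Q : probability Omega R) (S : solver R n Omega)
    (M : 'M[R]_n) (klo khi T : R) (a : nat) : Prop :=
  forall (kappa eps delta : R) (v : 'cV[R]_n),
    klo <= kappa <= khi -> 0 < eps < 1 -> 0 < delta < 1 ->
    with_prob_ge Q (1 - delta)
      [set w | l2norm (answer S w kappa eps delta v
                       - invmx (M + kappa%:M) *m v) <= eps * l2norm v] /\
    forall w, 0 <= duration S w kappa eps delta v
                <= T * (1 + ln eps^-1 + ln delta^-1) ^+ a.

Definition approx_sqrt_solver {n : nat} {d : measure_display}
    {W : measurableType d} (P : probability W R) (M : 'M[R]_n) (eps delta : R)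
    (out : 'cV[R]_n -> W -> 'cV[R]_n) : Prop :=
  forall v : 'cV[R]_n,
    with_prob_ge P (1 - delta)
      [set w | l2norm (out v w - sqrtmx M *m v)
                 <= eps * l2norm (sqrtmx M *m v)].

(* The factors hidden by soft-O notation are the powers of this quantity.  It
   does not absorb ln (1/eps') for the accuracies eps' demanded from a solver of
   the shifted systems: that accuracy is absolute, eps' * |v|, so that it must
   be below 1/mu to be of any use, and ln (1/eps') grows with the scale of M
   when lambda > 1. *)
Definition logs (n : nat) (mu lambda eps delta : R) : R :=
  1 + ln (lambda / mu) + ln n%:R + ln eps^-1 + ln delta^-1.

End Randomness.

(* Main.v *)
(* Write phi(x) for the product of (x - k_j) / (x + k_j) over nodes k_j spread
   geometrically over [mu, e lambda], about log(1/eps) of them per unit of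
   log x, so that |phi| is at most eps/4 on [mu, lambda].  For each t > 0 the
   kernel (1 - phi(x) phi(t)) / (x + t) is a combination of the 1 / (x + k_j);
   averaging over t against a discretisation of
   x^(-1/2) = (1/pi) int t^(-1/2) / (x + t) dt gives such a combination r(x)
   with x r(x) = (1 + O(eps)) sqrt x, whatever the number of atoms of the
   discretisation.  Hence sqrt x is approximated by
   w0 + sum_j w_j / (x + k_j) with polylogarithmically many terms, and weights
   whose logarithms are polylogarithmic up to scale.
   Expanding r in simple fractions makes every solver call a query on the input
   vector v itself.  This matters: the answers of the solver need not be
   measurable, so the success of calls whose arguments depend on earlier answers
   could not be controlled. *)

Require Import Defs.
From mathcomp Require Import all_boot all_order all_algebra.
From mathcomp Require Import all_classical all_reals all_analysis.
From mathcomp Require Import complex spectral ring lra.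

Set Implicit Arguments.
Unset Strict Implicit.
Unset Printing Implicit Defensive.

Import Order.TTheory GRing.Theory Num.Theory.
Import numFieldNormedType.Exports.

Local Open Scope ring_scope.

(** * The real spectral theorem *)

Section RealSpectral.
Context {R : rcfType}.

(** Over [R[i]] the matrix becomes Hermitian, so its spectral diagonal is real, and being an
    eigenvalue descends along the embedding of [R]. *)
Lemma symmetric_eigenvalue n (A : 'M[R]_n.+1) :
  A^T = A -> exists a, eigenvalue A a.
Proof.
move=> sA; pose toC := real_complex R.
pose AC := map_mx toC A : 'M[R[i]]_n.+1.
have hA : AC \is hermsymmx.
  apply/is_hermitianmxP; rewrite expr0 scale1r; apply/matrixP=> i j.
  by rewrite !mxE -[in LHS]sA mxE conj_Creal//; apply/complex_realP; eexists.
have /orthomx_spectralP eA := hermitian_normalmx hA.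
have /mxOverP/(_ 0 0)/complex_realP[a ea] := hermitian_spectral_diag_real hA.
exists a; rewrite -(eigenvalue_map toC); apply/eigenvalueP.
exists (row 0 (spectralmx AC)); last first.
  apply/negP => /eqP r0; have := spectral_unit AC.
  rewrite -row_free_unit => /row_freeP[B PB].
  have /(congr1 (row 0)) := PB; rewrite row_mul r0 mul0mx => /matrixP/(_ 0 0).
  by rewrite !mxE eqxx => /eqP; rewrite eq_sym oner_eq0.
rewrite -/AC -row_mul {2}eA !mulmxA mulmxV ?spectral_unit// mul1mx.
by rewrite row_mul row_diag_mx -scalemxAl -rowE ea.
Qed.

Lemma row_dot_eq0 n (x : 'rV[R]_n) : (x *m x^T) 0 0 = 0 -> x = 0.
Proof.
have -> : (x *m x^T) 0 0 = \sum_i x 0 i ^+ 2.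
  by rewrite mxE; apply: eq_bigr => i _; rewrite mxE expr2.
move=> /eqP; rewrite psumr_eq0 => [/allP x0|i _]; last by rewrite sqr_ge0.
apply/rowP=> i; have := x0 i (mem_index_enum _); rewrite /= sqrf_eq0 => /eqP ->.
by rewrite mxE.
Qed.

(** [H] is the reflection in the hyperplane orthogonal to [u - e], with [e] the first basis row;
    both rows have length 1, so it exchanges them. *)
Lemma householder n (u : 'rV[R]_n.+1) : u *m u^T = 1%:M ->
  exists H : 'M[R]_n.+1, [/\ H^T = H, H *m H = 1%:M & delta_mx 0 0 *m H = u].
Proof.
move=> u1; pose e : 'rV[R]_n.+1 := delta_mx 0 0; pose w := u - e.
pose c : R := (w *m w^T) 0 0.
have wE : w *m w^T = c%:M by rewrite [LHS]mx11_scalar.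
have ee : e *m e^T = 1%:M.
  apply/matrixP=> i j; rewrite trmx_delta mul_delta_mx !ord1 !mxE.
  by rewrite !eqxx.
pose s : R := (e *m w^T) 0 0.
have sE : e *m w^T = s%:M by rewrite [LHS]mx11_scalar.
have s'E : w *m e^T = s%:M by rewrite -[RHS]tr_scalar_mx -sE trmx_mul trmxK.
have cs : c = - (2 * s).
  have : c%:M = - (2 * s)%:M :> 'M[R]_1.
    have uE : u = w + e by rewrite subrK.
    have : c%:M + s%:M + (s%:M + 1%:M) = 1%:M :> 'M[R]_1.
      by rewrite -{1}wE -{1}s'E -{1}sE -{1}ee -mulmxDr -mulmxDr -mulmxDl -linearD -uE.
    move=> /matrixP/(_ 0 0); rewrite !mxE eqxx !mulr1n => h.
    by apply/matrixP=> i j; rewrite !ord1 !mxE eqxx !mulr1n; lra.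
  by move=> /matrixP/(_ 0 0); rewrite !mxE eqxx !mulr1n.
have w0 : c = 0 -> w = 0 by apply: row_dot_eq0.
(* If [u = e], then [c = 0] and [2 / c = 0], so this is the identity. *)
exists (1%:M - (2 / c) *: (w^T *m w)); split.
- by rewrite linearB/= trmx1 linearZ/= trmx_mul trmxK.
- rewrite mulmxBr mulmxBl mul1mx mulmx1 mulmxBl mul1mx -scalemxAl -!scalemxAr.
  rewrite -mulmxA [w *m _]mulmxA wE mul_scalar_mx -scalemxAr !scalerA.
  case: (eqVneq c 0) => [/w0->|c0]; first by rewrite mulmx0 !scaler0 !subr0.
  rewrite -scalerBl -addrA -opprD -scalerDl [X in X *: _](_ : _ = 0); last by field.
  by rewrite scale0r subr0.
- rewrite -/e mulmxBr mulmx1 -scalemxAr mulmxA sE mul_scalar_mx scalerA.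
  case: (eqVneq c 0) => [/w0 w0'|c0].
    by rewrite w0' scaler0 subr0; apply/esym/eqP; rewrite -subr_eq0 -/w w0'.
  rewrite (_ : 2 / c * s = -1); first by rewrite scaleN1r opprK addrC subrK.
  rewrite (_ : s = - (c / 2)); first by field.
  by rewrite cs; field.
Qed.

(* Deflation: conjugating by a reflection that exchanges the first basis vector
   with a unit eigenvector splits off a 1 x 1 block. *)
Theorem real_spectral n (A : 'M[R]_n) : A^T = A ->
  exists (U : 'M[R]_n) (d : 'rV[R]_n),
    U^T *m U = 1%:M /\ A = U^T *m diag_mx d *m U.
Proof.
elim: n A => [|n IHn] A sA.
  by exists 1%:M, 0; split; apply/matrixP => -[].
have [a /eigenvalueP[x xA x0]] := symmetric_eigenvalue sA.
pose c : R := (x *m x^T) 0 0.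
have c0 : 0 < c.
  rewrite lt0r (contra_neq (@row_dot_eq0 _ x))//= /c mxE sumr_ge0// => i _.
  by rewrite mxE -expr2 sqr_ge0.
pose u := (Num.sqrt c)^-1 *: x.
have uu : u *m u^T = 1%:M.
  rewrite linearZ/= -scalemxAl -scalemxAr scalerA [x *m _]mx11_scalar -/c.
  rewrite scale_scalar_mx -invfM -expr2 sqr_sqrtr ?ltW//.
  by rewrite mulVf// gt_eqF.
have [H [sH HH eH]] := householder uu.
have [B BE] : exists B, B = H *m A *m H by eexists.
pose B1 : 'M[R]_(1 + n) := B.
have sB : B^T = B by rewrite BE !trmx_mul sH sA mulmxA.
have uA : u *m A = a *: u by rewrite -scalemxAl xA scalerA mulrC -scalerA.
(* The first row of [B] is [a] times a basis row; by symmetry the first column is alike, which makes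
   [B] block diagonal. *)
have eB : (delta_mx 0 0 : 'rV_n.+1) *m B = a *: delta_mx 0 0.
  by rewrite BE !mulmxA eH uA -scalemxAl -eH -[_ *m H *m H]mulmxA HH mulmx1.
have Bu0 : ursubmx B1 = 0.
  apply/matrixP=> i j; rewrite ord1 !mxE.
  have /matrixP/(_ 0 (rshift 1 j)) := eB.
  by rewrite -rowE !mxE/= mulr0; move=> <-; congr (B _ _); apply/val_inj.
have Bd0 : dlsubmx B1 = 0.
  by rewrite -[dlsubmx B1]trmxK trmx_dlsub [B1^T]sB Bu0 trmx0.
have Bul : ulsubmx B1 = a%:M.
  apply/matrixP=> i j; rewrite !ord1 !mxE.
  have /matrixP/(_ 0 0) := eB.
  rewrite -rowE !mxE/= mulr1 => <-; congr (B _ _); exact/val_inj.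
have sdr : (drsubmx B1)^T = drsubmx B1 by rewrite trmx_drsub [B1^T]sB.
have [V [d [VV Bdr]]] := IHn _ sdr.
pose U1 : 'M[R]_(1 + n) := block_mx 1%:M 0 0 V.
have UU : U1^T *m U1 = 1%:M.
  rewrite tr_block_mx !trmx0 trmx1 mulmx_block !mulmx0 !mul0mx mulmx1 VV.
  by rewrite !(addr0, add0r) -scalar_mx_block.
have UB : B = U1^T *m diag_mx (row_mx a%:M d) *m U1.
  rewrite tr_block_mx !trmx0 trmx1 diag_mx_row !mulmx_block.
  rewrite !(mulmx0, mul0mx, mulmx1, mul1mx, addr0, add0r) -Bdr.
  have -> : diag_mx (a%:M) = ulsubmx B1.
    by rewrite Bul; apply/matrixP=> i j; rewrite !ord1 !mxE eqxx !mulr1n.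
  by rewrite -[LHS]/B1 -{1}(submxK B1) Bu0 Bd0.
exists ((U1 : 'M[R]_n.+1) *m H), (row_mx a%:M d); split.
  by rewrite trmx_mul sH -mulmxA [U1^T *m _]mulmxA UU mul1mx.
rewrite trmx_mul sH.
transitivity (H *m B *m H).
  by rewrite BE !mulmxA HH mul1mx -mulmxA HH mulmx1.
by rewrite {1}UB !mulmxA.
Qed.

End RealSpectral.

(** * Euclidean norms and square roots of matrices *)

Section EuclideanNorm.
Context {R : realType} {n : nat}.
Implicit Types (u v : 'cV[R]_n) (A U : 'M[R]_n).

Lemma sqr_l2norm v : l2norm v ^+ 2 = \sum_i v i 0 ^+ 2.
Proof. by rewrite sqr_sqrtr// sumr_ge0// => i _; rewrite sqr_ge0. Qed.

Lemma l2norm_ge0 v : 0 <= l2norm v.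
Proof. exact: sqrtr_ge0. Qed.

Lemma l2norm_le u v (c : R) : 0 <= c ->
  (forall i, u i 0 ^+ 2 <= c ^+ 2 * v i 0 ^+ 2) -> l2norm u <= c * l2norm v.
Proof.
move=> c0 uv; rewrite -(@ler_pXn2r _ 2)// ?nnegrE ?mulr_ge0 ?l2norm_ge0//.
by rewrite exprMn !sqr_l2norm mulr_sumr ler_sum.
Qed.

Lemma sqr_l2norm_trmx v : l2norm v ^+ 2 = (v^T *m v) 0 0.
Proof. by rewrite sqr_l2norm mxE; apply: eq_bigr => i _; rewrite mxE expr2. Qed.

Lemma l2normZ (a : R) v : l2norm (a *: v) = `|a| * l2norm v.
Proof.
rewrite /l2norm -sqrtr_sqr -sqrtrM ?sqr_ge0//; congr Num.sqrt.
by rewrite mulr_sumr; apply: eq_bigr => i _; rewrite mxE exprMn.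
Qed.

Lemma l2norm0 : l2norm (0 : 'cV[R]_n) = 0.
Proof. by rewrite -(scale0r 0) l2normZ normr0 mul0r. Qed.

Lemma l2norm_eq0 v : l2norm v = 0 -> v = 0.
Proof.
move=> /(congr1 (fun x => x ^+ 2)); rewrite sqr_l2norm expr0n/= => /eqP.
rewrite psumr_eq0 => [/allP v0|i _]; last by rewrite sqr_ge0.
apply/colP=> i; have := v0 i (mem_index_enum _); rewrite /= sqrf_eq0 => /eqP ->.
by rewrite mxE.
Qed.

Lemma ler_l2normD u v : l2norm (u + v) <= l2norm u + l2norm v.
Proof.
set a := l2norm u; set b := l2norm v.
have [a0|a0] := eqVneq a 0; first by rewrite (l2norm_eq0 a0) add0r a0 add0r.
have [b0|b0] := eqVneq b 0; first by rewrite (l2norm_eq0 b0) addr0 b0 addr0.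
have {}a0 : 0 < a by rewrite lt0r a0 l2norm_ge0.
have {}b0 : 0 < b by rewrite lt0r b0 l2norm_ge0.
rewrite -(@ler_pXn2r _ 2)// ?nnegrE ?l2norm_ge0// ?addr_ge0 ?(ltW a0) ?(ltW b0)//.
(* AM-GM: (x + y)^2 <= (1 + b / a) x^2 + (1 + a / b) y^2 in each coordinate *)
rewrite (_ : (a + b) ^+ 2 = (1 + b / a) * a ^+ 2 + (1 + a / b) * b ^+ 2); last first.
  by field; rewrite !gt_eqF.
rewrite sqr_l2norm [a ^+ 2]sqr_l2norm [b ^+ 2]sqr_l2norm.
rewrite !mulr_sumr -big_split/= ler_sum// => i _; rewrite mxE.
set x := u i 0; set y := v i 0.
rewrite -subr_ge0 (_ : _ - _ = (b * x - a * y) ^+ 2 / (a * b)); last first.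
  by field; rewrite !gt_eqF.
by rewrite divr_ge0 ?sqr_ge0// mulr_ge0 ?ltW.
Qed.

Lemma ler_l2norm_sum (N : nat) (f : nat -> 'cV[R]_n) :
  l2norm (\sum_(i < N) f i) <= \sum_(i < N) l2norm (f i).
Proof.
elim: N => [|N IHN]; first by rewrite !big_ord0 l2norm0.
by rewrite !big_ord_recr/= (le_trans (ler_l2normD _ _))// lerD2r.
Qed.

Lemma l2norm_orthogonal U v : U^T *m U = 1%:M -> l2norm (U *m v) = l2norm v.
Proof.
move=> UU; apply/eqP; rewrite -(@eqrXn2 _ 2)// ?l2norm_ge0//.
by rewrite !sqr_l2norm_trmx trmx_mul -mulmxA [U^T *m _]mulmxA UU mul1mx.
Qed.

Lemma quad_form_diag U (d : 'rV[R]_n) v :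
  quad_form (U^T *m diag_mx d *m U) v = \sum_i d 0 i * (U *m v) i 0 ^+ 2.
Proof.
rewrite /quad_form -!mulmxA [diag_mx d *m _]mul_diag_mx mulmxA -trmx_mul mxE.
by apply: eq_bigr => i _; rewrite !mxE; ring.
Qed.

Lemma quad_form_scalar (a : R) v : quad_form a%:M v = a * l2norm v ^+ 2.
Proof. by rewrite /quad_form mul_mx_scalar -scalemxAl mxE sqr_l2norm_trmx. Qed.

Lemma orthogonal_coord U (i : 'I_n) :
  U^T *m U = 1%:M -> U *m (U^T *m (delta_mx i 0 : 'cV_n)) = delta_mx i 0.
Proof. by move=> /mulmx1C UU; rewrite mulmxA UU mul1mx. Qed.

(** The test vector is a unit eigenvector, a column of [U^T]; this turns bounds in the Loewner order
    into bounds on eigenvalues. *)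
Lemma quad_form_orthogonal_coord U (d : 'rV[R]_n) i : U^T *m U = 1%:M ->
  quad_form (U^T *m diag_mx d *m U) (U^T *m (delta_mx i 0 : 'cV_n)) = d 0 i.
Proof.
move=> UU; rewrite quad_form_diag orthogonal_coord// (bigD1 i)//= big1 ?addr0.
  by rewrite mxE !eqxx expr1n mulr1.
by move=> j ji; rewrite mxE (negbTE ji) expr0n mulr0.
Qed.

End EuclideanNorm.

(** * Square roots of matrices and rational functions of them *)

Section SquareRoot.
Context {R : realType} {n : nat}.
Implicit Types (v : 'cV[R]_n) (M S U : 'M[R]_n).

Lemma conj_diagM U (d e : 'rV[R]_n) : U^T *m U = 1%:M ->
  (U^T *m diag_mx d *m U) *m (U^T *m diag_mx e *m U) =
  U^T *m diag_mx (\row_i (d 0 i * e 0 i)) *m U.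
Proof.
move=> /mulmx1C UU; rewrite -mulmx_diag !mulmxA.
by rewrite -[_ *m U *m U^T]mulmxA UU mulmx1.
Qed.

(** [xget] picks an element as soon as one exists; square roots of the eigenvalues in an orthonormal
    eigenbasis provide it. *)
Lemma sqrtmxP M : psd_mx M -> psd_mx (sqrtmx M) /\ sqrtmx M *m sqrtmx M = M.
Proof.
move=> [sM pM]; rewrite /sqrtmx.
apply: (@xgetPex _ _ [set S | psd_mx S /\ S *m S = M]%classic).
have [U [d [UU eM]]] := real_spectral sM.
have d0 i : 0 <= d 0 i by rewrite -(quad_form_orthogonal_coord d i UU) -eM.
pose e := \row_i Num.sqrt (d 0 i).
exists (U^T *m diag_mx e *m U); split; first split.
- by rewrite /symmetric_mx !trmx_mul trmxK tr_diag_mx mulmxA.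
- move=> v; rewrite quad_form_diag sumr_ge0// => i _.
  by rewrite mulr_ge0 ?sqr_ge0// mxE sqrtr_ge0.
- rewrite conj_diagM// eM; congr (_ *m diag_mx _ *m _).
  by apply/rowP=> i; rewrite !mxE -expr2 sqr_sqrtr.
Qed.

Variables (M : 'M[R]_n) (mu lambda : R).
Hypotheses (mu0 : 0 < mu) (pM : psd_mx M).
Hypotheses (muM : loewner_le mu%:M M) (Mlambda : loewner_le M lambda%:M).

(** The square of the right-hand side is [quad_form M v]. This converts solver errors, which are
    multiples of [l2norm v], into errors relative to the output. *)
Lemma l2norm_sqrtmx_ge v : Num.sqrt mu * l2norm v <= l2norm (sqrtmx M *m v).
Proof.
have [[sS pS] SS] := sqrtmxP pM.
rewrite -(@ler_pXn2r _ 2)// ?nnegrE ?mulr_ge0 ?l2norm_ge0 ?sqrtr_ge0//.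
rewrite exprMn sqr_sqrtr ?(ltW mu0)// -quad_form_scalar (le_trans (muM v))//.
by rewrite sqr_l2norm_trmx trmx_mul sS -mulmxA [sqrtmx M *m (_ *m v)]mulmxA SS mulmxA.
Qed.

(** Each diagonal entry is the quadratic form at a basis vector, hence at least [mu]. Costs linear
    in [n] can thus be charged to [nnz M]. *)
Lemma nnz_ge : (n <= nnz M)%N.
Proof.
have diag0 i : M i i != 0.
  have := muM (delta_mx i 0); rewrite /quad_form trmx_delta -!rowE.
  rewrite -!colE !mxE eqxx mulr1n => /(lt_le_trans mu0).
  by rewrite lt0r => /andP[].
have inj : injective (fun i : 'I_n => (i, i)) by move=> i j [].
rewrite -[X in (X <= _)%N]card_ord -(card_imset predT inj).
apply: subset_leq_card; apply/fintype.subsetP => ij /imsetP[i _ ->].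
by rewrite inE/=.
Qed.

(** Diagonalising the square root [S] rather than [M] makes [S], [M = S^2] and all shifted inverses
    diagonal in one orthonormal basis, where the scalar estimate applies coordinate by
    coordinate. *)
Theorem rational_sqrt_error (c w0 : R) (N : nat) (w kap : nat -> R) v :
  0 <= c -> (forall l, (l < N)%N -> 0 < kap l) ->
  (forall x, mu <= x <= lambda ->
     `|w0 + \sum_(l < N) w l / (x + kap l) - Num.sqrt x| <= c * Num.sqrt x) ->
  l2norm (w0 *: v + \sum_(l < N) w l *: (invmx (M + (kap l)%:M) *m v)
          - sqrtmx M *m v) <= c * l2norm (sqrtmx M *m v).
Proof.
move=> c0 kap0 happ; have [[sS pS] SS] := sqrtmxP pM.
set S := sqrtmx M in sS pS SS *.
have [U [d [UU eS]]] := real_spectral sS.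
have UU' := mulmx1C UU.
have d0 i : 0 <= d 0 i by rewrite -(quad_form_orthogonal_coord d i UU) -eS.
have eM : M = U^T *m diag_mx (\row_i (d 0 i ^+ 2)) *m U.
  by rewrite -SS eS conj_diagM.
have dle i : mu <= d 0 i ^+ 2 <= lambda.
  have qM : quad_form M (U^T *m (delta_mx i 0 : 'cV_n)) = d 0 i ^+ 2.
    by rewrite eM quad_form_orthogonal_coord// mxE.
  have q1 : l2norm (U^T *m (delta_mx i 0 : 'cV[R]_n)) ^+ 2 = 1.
    rewrite l2norm_orthogonal ?trmxK// sqr_l2norm_trmx trmx_delta mul_delta_mx.
    by rewrite mxE !eqxx.
  have := muM (U^T *m (delta_mx i 0 : 'cV_n)).
  have := Mlambda (U^T *m (delta_mx i 0 : 'cV_n)).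
  by rewrite qM !quad_form_scalar q1 !mulr1 => -> ->.
have inv l : (l < N)%N -> invmx (M + (kap l)%:M) =
    U^T *m diag_mx (\row_i (d 0 i ^+ 2 + kap l)^-1) *m U.
  move=> lN; have sh : M + (kap l)%:M =
      U^T *m diag_mx (\row_i (d 0 i ^+ 2 + kap l)) *m U.
    rewrite (_ : \row_i _ = \row_i (d 0 i ^+ 2) + const_mx (kap l)); last first.
      by apply/rowP=> i; rewrite !mxE.
    rewrite linearD/= mulmxDr mulmxDl -eM diag_const_mx.
    by rewrite mul_mx_scalar -scalemxAl UU scalemx1.
  have MV : (M + (kap l)%:M) *m (U^T *m diag_mx (\row_i (d 0 i ^+ 2 + kap l)^-1) *m U) = 1%:M.
    rewrite sh conj_diagM// (_ : \row_i _ = const_mx 1); last first.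
      apply/rowP=> i; rewrite !mxE mulfV// gt_eqF// ltr_wpDl ?sqr_ge0//.
      exact: kap0.
    by rewrite diag_const_mx mulmx1.
  have [uM _] := mulmx1_unit MV.
  by rewrite -[LHS]mulmx1 -MV mulmxA mulVmx// mul1mx.
pose g (i : 'I_n) := w0 + \sum_(l < N) w l / (d 0 i ^+ 2 + kap l) - d 0 i.
have -> : w0 *: v + \sum_(l < N) w l *: (invmx (M + (kap l)%:M) *m v) - S *m v
    = U^T *m (diag_mx (\row_i g i) *m (U *m v)).
  set X := (X in X = _).
  transitivity (U^T *m (U *m X)); first by rewrite [RHS]mulmxA UU mul1mx.
  congr (_ *m _); rewrite {}/X mulmxBr mulmxDr mulmx_sumr -scalemxAr.
  have -> : U *m (S *m v) = diag_mx d *m (U *m v).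
    by rewrite eS !mulmxA UU' mul1mx.
  apply/colP=> i; rewrite !mul_diag_mx !mxE summxE mulrBl mulrDl mulr_suml.
  congr (_ + _ - _).
  apply: eq_bigr => l _; rewrite inv// -scalemxAr !mulmxA UU' mul1mx -!mulmxA.
  by rewrite mul_diag_mx !mxE mulrA.
have SE : l2norm (S *m v) = l2norm (diag_mx d *m (U *m v)).
  by rewrite eS -!mulmxA l2norm_orthogonal ?trmxK.
rewrite {}SE l2norm_orthogonal ?trmxK//.
move: (U *m v) => y; apply: l2norm_le => // i; rewrite !mul_diag_mx !mxE -/(g i) !exprMn [c ^+ 2 * _]mulrA.
apply: ler_wpM2r; first exact: sqr_ge0.
rewrite -exprMn -(real_normK (num_real (g i))).
rewrite ler_pXn2r ?nnegrE ?mulr_ge0//.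
by have := happ _ (dle i); rewrite sqrtr_sqr (ger0_norm (d0 i)).
Qed.

End SquareRoot.

(** * Rational approximation of the square root *)

Section TakenakaMalmquist.
Context {R : realType} (kap : nat -> R).

(** The Blaschke product of the right half-plane with zeros at the first [j] nodes, on the real
    axis. *)
Definition blaschke (j : nat) (x : R) : R :=
  \prod_(k < j) ((x - kap k) / (x + kap k)).

(** Up to normalisation, the result of orthogonalising the [1 / (x + kap j)] in the Hardy space of
    the right half-plane. *)
Definition malmquist (j : nat) (x : R) : R := blaschke j x / (x + kap j).

Lemma blaschkeS j x :
  blaschke j.+1 x = blaschke j x * ((x - kap j) / (x + kap j)).
Proof. by rewrite /blaschke big_ord_recr. Qed.

(* The Christoffel-Darboux formula of the Takenaka-Malmquist system; it separates
   the variables x and t. *)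
Lemma blaschke_kernel (N : nat) (x t : R) :
  (forall k, 0 < kap k) -> 0 < x -> 0 < t ->
  (1 - blaschke N x * blaschke N t) / (x + t) =
  \sum_(j < N) 2 * kap j * malmquist j x * malmquist j t.
Proof.
move=> kap0 x0 t0; have xt0 : x + t != 0 by rewrite gt_eqF ?addr_gt0.
elim: N => [|N IHN].
  by rewrite big_ord0 /blaschke !big_ord0 mulr1 subrr mul0r.
rewrite big_ord_recr/= -IHN /malmquist !blaschkeS.
have xk0 : x + kap N != 0 by rewrite gt_eqF ?addr_gt0.
have tk0 : t + kap N != 0 by rewrite gt_eqF ?addr_gt0.
by field; rewrite xt0 xk0 tk0.
Qed.

Lemma norm_mobius_le1 (k x : R) : 0 < k -> 0 <= x -> `|(x - k) / (x + k)| <= 1.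
Proof.
move=> k0 x0; rewrite normrM normfV [`|x + k|]gtr0_norm ?ltr_wpDl//.
by rewrite ler_pdivrMr ?ltr_wpDl// mul1r ler_norml; apply/andP; split; lra.
Qed.

Lemma norm_blaschke_le1 j x :
  (forall k, 0 < kap k) -> 0 <= x -> `|blaschke j x| <= 1.
Proof.
move=> kap0 x0; elim: j => [|j IHj]; first by rewrite /blaschke big_ord0 normr1.
by rewrite blaschkeS normrM mulr_ile1// norm_mobius_le1.
Qed.

(** The absolute sum of the weights is tracked because it is the factor by which solver errors are
    amplified; it decides the accuracy to demand. *)
Definition simple_fractions (N : nat) (g : R -> R) (c : R) : Prop :=
  exists w : nat -> R,
    (forall x, 0 < x -> g x = \sum_(l < N) w l / (x + kap l)) /\
    \sum_(l < N) `|w l| <= c.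

Lemma simple_fractions_widen (N N' : nat) g c : (N <= N')%N ->
  simple_fractions N g c -> simple_fractions N' g c.
Proof.
move=> NN' [w [gw wc]]; exists (fun l => if (l < N)%N then w l else 0); split.
  move=> x x0; rewrite gw// (big_ord_widen _ (fun l => w l / (x + kap l)) NN').
  rewrite big_mkcond/=; apply: eq_bigr => l _.
  by case: ifP => // _; rewrite mul0r.
apply: le_trans wc; rewrite (big_ord_widen _ (fun l => `|w l|) NN').
rewrite [leRHS]big_mkcond/=; apply: ler_sum => l _.
by case: ifP => // _; rewrite normr0.
Qed.

Lemma simple_fractions_sum (N J : nat) (g : nat -> R -> R) (c b : nat -> R) :
  (forall j, (j < J)%N -> simple_fractions N (g j) (c j)) ->
  simple_fractions N (fun x => \sum_(j < J) b j * g j x)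
    (\sum_(j < J) `|b j| * c j).
Proof.
elim: J => [_|J IHJ gc].
  exists (fun=> 0); split => [x _|]; rewrite big_ord0.
    by rewrite big1// => l _; rewrite mul0r.
  by rewrite big1// => l _; rewrite normr0.
have [w [ew wc]] := IHJ (fun j jJ => gc j (ltnW jJ)).
have [w' [ew' wc']] := gc J (ltnSn J).
exists (fun l => w l + b J * w' l); split.
  move=> x x0; rewrite big_ord_recr/= ew// ew'// mulr_sumr -big_split/=.
  by apply: eq_bigr => l _; rewrite mulrDl mulrA.
rewrite big_ord_recr/=.
apply: (@le_trans _ _ (\sum_(l < N) (`|w l| + `|b J| * `|w' l|))).
  by apply: ler_sum => l _; rewrite (le_trans (ler_normD _ _))// normrM.
by rewrite big_split/= -mulr_sumr lerD// ler_wpM2l.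
Qed.

Variables (N : nat) (mu Lambda G : R).
Hypotheses (mu0 : 0 < mu) (G1 : 1 <= G).
Hypothesis kap_range : forall k, (k < N)%N -> mu <= kap k <= Lambda.
Hypothesis kap_gap :
  forall l k, (l < k)%N -> (k < N)%N -> kap k <= G * (kap k - kap l).

Local Notation H := (3 + 4 * G).

(** Induction along [B_(j+1) = B_j - 2 k_j B_j / (x + k_j)]. Multiplying [1 / (x + k_l)] by
    [1 / (x + k_j)] and splitting again divides by [k_j - k_l], which [G] controls relative to
    [k_j]; [H] bounds the resulting growth per node. *)
Lemma blaschke_fractions (j : nat) : (j <= N)%N ->
  simple_fractions j (fun x => blaschke j x - 1) (Lambda * (H ^+ j - 1)) /\
  ((j < N)%N -> simple_fractions j.+1 (malmquist j) (Lambda / mu * H ^+ j.+1)).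
Proof.
have g1 : 1 <= G := G1.
have H1 i : 1 <= H ^+ i by rewrite exprn_ege1//; lra.
(* The bound on [kap i] times the weight sum feeds the recursion for [blaschke]; the cruder last
   bound is the one claimed for [malmquist]. *)
have step i : (i < N)%N ->
    simple_fractions i (fun x => blaschke i x - 1) (Lambda * (H ^+ i - 1)) ->
    exists B : nat -> R,
    [/\ forall x, 0 < x -> malmquist i x = \sum_(l < i.+1) B l / (x + kap l),
        kap i * \sum_(l < i.+1) `|B l| <= kap i + 2 * G * (Lambda * (H ^+ i - 1)) &
        \sum_(l < i.+1) `|B l| <= Lambda / mu * H ^+ i.+1].
  move=> iN [A [eA Ac]].
  have /andP[muk kL] := kap_range iN; have k0 := lt_le_trans mu0 muk.
  have gap (l : 'I_i) : 0 < kap i - kap l.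
    have := kap_gap (ltn_ord l) iN => /(lt_le_trans k0).
    by rewrite (pmulr_rgt0 _ (lt_le_trans ltr01 G1)).
  (* Each old fraction leaves its weight over the gap at the old pole, and the opposite weight at
     the new pole [- kap i]. *)
  pose B l := if (l < i)%N then A l / (kap i - kap l)
              else 1 - \sum_(l < i) A l / (kap i - kap l).
  have eB (F : R -> nat -> R) : \sum_(l < i.+1) F (B l) l =
      \sum_(l < i) F (A l / (kap i - kap l)) l
      + F (1 - \sum_(l < i) A l / (kap i - kap l)) i.
    rewrite big_ord_recr/= {2}/B ltnn; congr (_ + _).
    by apply: eq_bigr => l _; rewrite /B ltn_ord.
  have AG : kap i * \sum_(l < i) `|A l / (kap i - kap l)| <= G * (Lambda * (H ^+ i - 1)).
    apply: (@le_trans _ _ (G * \sum_(l < i) `|A l|)); last by rewrite ler_wpM2l//; lra.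
    rewrite !mulr_sumr; apply: ler_sum => l _; have gl := gap l.
    rewrite normrM normfV [`|kap i - kap l|]gtr0_norm// !mulrA ler_pdivrMr//.
    rewrite [G * _]mulrC -mulrA [kap i * _]mulrC ler_wpM2l//.
    exact: (kap_gap (ltn_ord l) iN).
  have Bc : kap i * \sum_(l < i.+1) `|B l| <= kap i + 2 * G * (Lambda * (H ^+ i - 1)).
    rewrite (eB (fun b _ => `|b|)).
    have := ler_normB 1 (\sum_(l < i) A l / (kap i - kap l)); rewrite normr1.
    have := ler_norm_sum (index_enum 'I_i) (fun l : 'I_i => A l / (kap i - kap l)) predT.
    move: AG; set s := \sum_(l < i) `|_|; set s' := `|_|; set s'' := `|_ - _| => AG ss' ss''.
    have : kap i * (s + s'') <= kap i * (1 + 2 * s) by rewrite ler_pM2l//; lra.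
    by lra.
  exists B; split => //.
  - move=> x x0; rewrite (eB (fun b l => b / (x + kap l))) /malmquist.
    have xk : x + kap i != 0 by rewrite gt_eqF ?addr_gt0.
    have -> : blaschke i x = 1 + \sum_(l < i) A l / (x + kap l).
      by rewrite -eA// addrC subrK.
    rewrite mulrDl mulrBl addrCA; congr (_ + _).
    rewrite !mulr_suml -sumrB; apply: eq_bigr => l _.
    have gl : kap i - kap l != 0 by rewrite gt_eqF ?gap.
    have xl : x + kap l != 0.
      have /andP[+ _] := kap_range (ltn_trans (ltn_ord l) iN).
      by move=> /(lt_le_trans mu0) ?; rewrite gt_eqF ?addr_gt0.
    by field; rewrite gl xl xk.
  - rewrite -(ler_pM2l k0) (le_trans Bc)//.
    have Lmu : 1 <= Lambda / mu by rewrite ler_pdivlMr// mul1r (le_trans muk).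
    have L0 : 0 < Lambda by rewrite (lt_le_trans k0).
    apply: (@le_trans _ _ (Lambda * (H * H ^+ i))).
      have := H1 i; set h := H ^+ i => h1.
      have : kap i + 2 * G * (Lambda * (h - 1)) <= Lambda * (1 + 2 * G * (h - 1)) by lra.
      move=> /le_trans -> //; rewrite ler_pM2l//; nra.
    rewrite exprS [leRHS](_ : _ = kap i / mu * (Lambda * (H * H ^+ i))); last by ring.
    have Hi : 0 <= Lambda * (H * H ^+ i).
      by rewrite mulr_ge0 ?(ltW L0)// -exprS (le_trans ler01).
    by rewrite ler_peMl// ler_pdivlMr// mul1r.
elim: j => [_|j IHj jN].
  have z : simple_fractions 0 (fun x => blaschke 0 x - 1) (Lambda * (H ^+ 0 - 1)).
    exists (fun=> 0); split => [x _|]; rewrite big_ord0 ?expr0 ?subrr ?mulr0//.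
    by rewrite /blaschke big_ord0 subrr.
  by split=> // N0; have [B [? _ ?]] := step 0%N N0 z; exists B.
have [IH _] := IHj (ltnW jN).
have z : simple_fractions j.+1 (fun x => blaschke j.+1 x - 1) (Lambda * (H ^+ j.+1 - 1)).
  have [B [eB Bc _]] := step j jN IH; have [A [eA Ac]] := simple_fractions_widen (leqnSn j) IH.
  have /andP[muk kL] := kap_range jN; have k0 := lt_le_trans mu0 muk.
  exists (fun l => A l - 2 * kap j * B l); split.
    move=> x x0; have xk : x + kap j != 0 by rewrite gt_eqF ?addr_gt0.
    transitivity ((blaschke j x - 1) - 2 * kap j * malmquist j x).
      by rewrite blaschkeS /malmquist; field.
    rewrite eA// eB// mulr_sumr -sumrB; apply: eq_bigr => l _.
    by rewrite mulrBl mulrA.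
  apply: (@le_trans _ _ (\sum_(l < j.+1) (`|A l| + 2 * kap j * `|B l|))).
    apply: ler_sum => l _; rewrite (le_trans (ler_normB _ _))//.
    by rewrite normrM [`|2 * _|]gtr0_norm ?mulr_gt0.
  rewrite big_split/= -mulr_sumr -mulrA.
  have := H1 j; rewrite exprS; move: Ac Bc.
  set sA := \sum_(_ < _) _; set sB := \sum_(_ < _) _; set h := H ^+ j => Ac Bc h1.
  apply: (@le_trans _ _ (Lambda * (h - 1) + 2 * (Lambda + 2 * G * (Lambda * (h - 1))))).
    by lra.
  have L0 : 0 < Lambda by rewrite (lt_le_trans k0).
  rewrite [leLHS](_ : _ = Lambda * ((h - 1) + 2 * (1 + 2 * G * (h - 1)))); last by ring.
  by rewrite ler_pM2l//; nra.
by split=> // N0; have [B [? _ ?]] := step j.+1 N0 z; exists B.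
Qed.

End TakenakaMalmquist.

(** * Discretisation of the Stieltjes integral for [x^(-1/2)] *)

Section Stieltjes.
Context {R : realType}.

(** Mean value theorem: the derivative [1 / (1 + z^2)] decreases for nonnegative [z]. *)
Lemma atan_increment (a b : R) : 0 <= a -> a < b ->
  (b - a) / (1 + b ^+ 2) <= atan b - atan a <= (b - a) / (1 + a ^+ 2).
Proof.
move=> a0 ab.
have datan z : z \in `]a, b[ -> is_derive z 1 atan (1 + z ^+ 2)^-1.
  by move=> _; exact: is_derive1_atan.
have catan : {within `[a, b], continuous atan}%classic.
  by apply: derivable_within_continuous => z _; exact: ex_derive.
have [c + ->] := MVT ab datan catan.
rewrite in_itv/= => /andP[/ltW ac /ltW cb].
have c0 : 0 <= c by apply: le_trans ac.
have pos (x : R) : 0 < 1 + x ^+ 2 by rewrite ltr_wpDr ?sqr_ge0.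
rewrite ![_^-1 * _]mulrC !ler_pM2l ?subr_gt0// !lef_pV2 ?posrE ?pos//.
have b0 := le_trans c0 cb.
by rewrite !lerD2l !ler_pXn2r ?nnegrE// ac cb.
Qed.

(** Sampling the decreasing derivative of [atan] at right endpoints underestimates the integral;
    moving to left endpoints adds at most the first term [y]. *)
Lemma riemann_atan (n : nat) (y : R) : 0 < y ->
  atan (n%:R * y) - y <= \sum_(i < n) y / (1 + (i.+1%:R * y) ^+ 2)
    <= atan (n%:R * y).
Proof.
move=> y0; have tele : atan (n%:R * y) =
    \sum_(i < n) (atan (i.+1%:R * y) - atan (i%:R * y)).
  elim: n => [|n IHn]; first by rewrite big_ord0 mul0r atan0.
  by rewrite big_ord_recr/= -IHn addrC subrK.
have inc (i : nat) : y / (1 + (i.+1%:R * y) ^+ 2)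
    <= atan (i.+1%:R * y) - atan (i%:R * y) <= y / (1 + (i%:R * y) ^+ 2).
  have := @atan_increment (i%:R * y) (i.+1%:R * y).
  rewrite (_ : i.+1%:R * y - i%:R * y = y); last by rewrite -natr1; ring.
  apply; first by rewrite mulr_ge0// ltW.
  by rewrite ltr_pM2r// ltr_nat.
apply/andP; split; last first.
  by rewrite tele; apply: ler_sum => i _; have /andP[] := inc i.
rewrite lerBlDr tele.
apply: (@le_trans _ _ (\sum_(i < n) y / (1 + (i%:R * y) ^+ 2))).
  by apply: ler_sum => i _; have /andP[] := inc i.
have -> : \sum_(i < n) y / (1 + (i%:R * y) ^+ 2) =
    \sum_(i < n) y / (1 + (i.+1%:R * y) ^+ 2) + y - y / (1 + (n%:R * y) ^+ 2).
  elim: n {tele} => [|n IHn].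
    by rewrite !big_ord0 mul0r expr0n/= addr0 divr1 add0r subrr.
  by rewrite !big_ord_recr/= IHn; ring.
by rewrite gerBl divr_ge0 ?(ltW y0)// addr_ge0 ?sqr_ge0.
Qed.

(* Riemann sums, after the substitution t = u^2, of
   1 / sqrt x = (2 / pi) int_0^oo du / (x + u^2). *)
Lemma inv_sqrt_stieltjes (lo hi eta : R) : 0 < lo -> 0 < eta < 1 ->
  exists (n : nat) (nu : R) (t : nat -> R),
  [/\ 0 <= nu, forall i, 0 < t i,
      forall x, 0 < x -> \sum_(i < n) nu / (x + t i) <= (Num.sqrt x)^-1 &
      forall x, lo <= x <= hi ->
        (1 - eta) / Num.sqrt x <= \sum_(i < n) nu / (x + t i)].
Proof.
move=> lo0 /andP[eta0 eta1].
have pi0 := pi_gt0 R.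
have pi2 := pi_ge2 R.
(* The mesh is such that, for [x >= lo], the discretisation loses at most
   [h / sqrt x <= eta / 2]. *)
pose h := eta * Num.sqrt lo / 2.
have h0 : 0 < h by rewrite divr_gt0// mulr_gt0// sqrtr_gt0.
(* At the cut-off [y] the arctangent is [pi * eta / 4] short of [pi / 2]; [n] is then large enough
   for the grid, rescaled by [sqrt x], to reach [y] for every [x <= hi]. *)
pose y := tan (pi / 2 * (1 - eta / 2)).
have aty : atan y = pi / 2 * (1 - eta / 2).
  by rewrite tanK// in_itv/=; apply/andP; split; nra.
pose n := (Num.truncn (`|y| * Num.sqrt hi / h)).+1.
exists n, (2 / pi * h), (fun i => (i.+1%:R * h) ^+ 2).
have riem x : 0 < x -> \sum_(i < n) 2 / pi * h / (x + (i.+1%:R * h) ^+ 2) =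
    2 / pi / Num.sqrt x * \sum_(i < n) h / Num.sqrt x / (1 + (i.+1%:R * (h / Num.sqrt x)) ^+ 2).
  move=> x0; rewrite mulr_sumr; apply: eq_bigr => i _.
  have s0 : 0 < Num.sqrt x by rewrite sqrtr_gt0.
  rewrite -{1}(sqr_sqrtr (ltW x0)); set s := Num.sqrt x in s0 *.
  move: (i.+1%:R : R) (pi : R) pi0 => k p p0.
  have p1 : s ^+ 2 + (k * h) ^+ 2 != 0.
    by rewrite gt_eqF// ltr_wpDr ?sqr_ge0// exprn_gt0.
  by field; rewrite p1 !gt_eqF.
split.
- exact: mulr_ge0 (divr_ge0 (ler0n _ 2) (ltW pi0)) (ltW h0).
- by move=> i; rewrite exprn_gt0// mulr_gt0.
- move=> x x0; rewrite riem//; have s0 : 0 < Num.sqrt x by rewrite sqrtr_gt0.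
  have /andP[_] := riemann_atan n (divr_gt0 h0 s0).
  move=> /le_trans/(_ (ltW (atan_ltpi2 _))) le2.
  rewrite mulrAC ler_piMl ?invr_ge0 ?(ltW s0)//.
  by rewrite mulrAC ler_pdivrMr// mul1r mulrC -ler_pdivlMr.
- move=> x /andP[lox xhi]; have x0 := lt_le_trans lo0 lox.
  rewrite riem//; have s0 : 0 < Num.sqrt x by rewrite sqrtr_gt0.
  have /andP[+ _] := riemann_atan n (divr_gt0 h0 s0).
  set T := \sum_(i < n) _ => le1.
  rewrite mulrAC ler_pM2r ?invr_gt0//.
  have hs : h / Num.sqrt x <= eta / 2.
    rewrite ler_pdivrMr// /h mulrAC ler_pM2l ?divr_gt0//.
    by rewrite ler_sqrt// ltW.
  have yn : y <= n%:R * (h / Num.sqrt x).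
    rewrite mulrA ler_pdivlMr// (@le_trans _ _ (`|y| * Num.sqrt hi))//.
      apply: (@le_trans _ _ (`|y| * Num.sqrt x)); first by rewrite ler_wpM2r ?ler_norm ?(ltW s0).
      by apply: ler_wpM2l => //; exact: ler_wsqrtr.
    by rewrite -ler_pdivrMr// ltW// /n truncnS_gt.
  have := le_atan yn; rewrite aty => aty'.
  have : pi / 2 * (1 - eta / 2) - eta / 2 <= T by lra.
  (* The losses [pi * eta / 4] and [eta / 2] total at most [pi * eta / 2], because [pi >= 2]. *)
  move=> le2; rewrite mulrAC ler_pdivlMr// mulrC -ler_pdivrMl//; nra.
Qed.

End Stieltjes.

(** * Simple fractions for the square root, and geometric nodes *)

Section Quadrature.
Context {R : realType}.

(** Discretising costs the relative error [eta]; replacing each [1 / (x + t i)] by the Blaschke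
    kernel costs at most [rho], as the Blaschke product at [t i] is at most 1 in absolute value. The
    kernel separates variables, so the atoms enter only through [beta j]. *)
Lemma sqrt_fractions (kap : nat -> R) (N : nat) (mu lambda Lambda G eta rho : R) :
  0 < mu -> 1 <= G -> 0 < eta < 1 -> (forall k, 0 < kap k) ->
  (forall k, (k < N)%N -> mu <= kap k <= Lambda) ->
  (forall l k, (l < k)%N -> (k < N)%N -> kap k <= G * (kap k - kap l)) ->
  (forall x, mu <= x <= lambda -> `|blaschke kap N x| <= rho) ->
  exists (w0 : R) (w : nat -> R),
    (forall x, mu <= x <= lambda ->
       `|w0 + \sum_(l < N) w l / (x + kap l) - Num.sqrt x|
         <= (eta + rho) * Num.sqrt x) /\
    \sum_(l < N) `|w l| <=
      Lambda * (N%:R * (2 * Num.sqrt Lambda * (Lambda / mu) * (3 + 4 * G) ^+ N)).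
Proof.
move=> mu0 G1 eta01 kap0 kap_range kap_gap phi_le.
have [n [nu [t [nu0 t0 stle stge]]]] := @inv_sqrt_stieltjes _ mu lambda _ mu0 eta01.
pose beta j := 2 * kap j * \sum_(i < n) nu * malmquist kap j (t i).
have H1 : 1 <= 3 + 4 * G by lra.
(* [|malmquist kap j t| <= 1 / (t + kap j)], so the sum is dominated by the discretised integral at
   [kap j], whose upper bound does not involve the number of atoms. *)
have betaE j : (j < N)%N -> `|beta j| <= 2 * Num.sqrt Lambda.
  move=> jN; have /andP[muj jL] := kap_range _ jN; have k0 := kap0 j.
  apply: (@le_trans _ _ (2 * Num.sqrt (kap j))); last first.
    by rewrite ler_pM2l// ler_wsqrtr.
  rewrite /beta normrM gtr0_norm ?mulr_gt0// -mulrA ler_pM2l//.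
  apply: (@le_trans _ _ (kap j * (Num.sqrt (kap j))^-1)); last first.
    by rewrite -{1}(sqr_sqrtr (ltW k0)) expr2 mulfK// gt_eqF ?sqrtr_gt0.
  rewrite ler_pM2l// (le_trans (ler_norm_sum _ _ _))// (le_trans _ (stle _ k0))//.
  apply: ler_sum => i _; have ti := t0 i.
  rewrite /malmquist !normrM (ger0_norm nu0) ler_wpM2l//.
  rewrite normfV [`|t i + _|]gtr0_norm ?addr_gt0// [kap j + _]addrC.
  by rewrite ler_piMl ?invr_ge0 ?norm_blaschke_le1 ?ltW ?addr_gt0.
have /simple_fractions_sum : forall j, (j < N)%N ->
    simple_fractions kap N (malmquist kap j) (Lambda / mu * (3 + 4 * G) ^+ N).
  move=> j jN; have [_ /(_ jN) sf] :=
    blaschke_fractions mu0 G1 kap_range kap_gap (ltnW jN).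
  have [w [ew wc]] := simple_fractions_widen jN sf.
  exists w; split => //; apply: (le_trans wc).
  rewrite ler_wpM2l ?ler_weXn2l//.
  have /andP[a b] := kap_range _ jN.
  by rewrite divr_ge0 ?(ltW mu0)// (le_trans _ b)// ltW.
move=> /(_ beta) [w [ew wc]].
(* Multiplication by [x] is absorbed through [x / (x + k) = 1 - k / (x + k)]. *)
exists (\sum_(l < N) w l), (fun l => - (w l * kap l)); split; last first.
  apply: (@le_trans _ _ (Lambda * \sum_(l < N) `|w l|)).
    rewrite mulr_sumr; apply: ler_sum => l _.
    have /andP[a b] := kap_range _ (ltn_ord l).
    rewrite normrN normrM mulrC ler_wpM2r// gtr0_norm//.
  have [->|N0] := eqVneq N 0%N; first by rewrite big_ord0 mul0r mulr0.
  have /kap_range/andP[a b] : (0 < N)%N by rewrite lt0n.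
  have L0 : 0 < Lambda by rewrite (lt_le_trans mu0)// (le_trans a).
  rewrite ler_pM2l// (le_trans wc)//.
  set Y := (X in _ <= N%:R * X); have -> : N%:R * Y = \sum_(j < N) Y.
    by rewrite sumr_const card_ord mulr_natl.
  apply: ler_sum => j _; rewrite {}/Y [leRHS](_ : _ = 2 * Num.sqrt Lambda * (Lambda / mu * (3 + 4 * G) ^+ N)); last first.
    by rewrite !mulrA.
  apply: ler_wpM2r; last exact: betaE.
  by rewrite mulr_ge0 ?divr_ge0 ?exprn_ge0 ?(ltW L0) ?(ltW mu0)// (le_trans ler01).
move=> x xr; have /andP[mux xl] := xr; have x0 := lt_le_trans mu0 mux.
have s0 : 0 < Num.sqrt x by rewrite sqrtr_gt0.
pose s := \sum_(i < n) nu / (x + t i).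
have rE : \sum_(j < N) beta j * malmquist kap j x =
    \sum_(i < n) nu / (x + t i) * (1 - blaschke kap N x * blaschke kap N (t i)).
  transitivity (\sum_(i < n) nu * \sum_(j < N) 2 * kap j * malmquist kap j x * malmquist kap j (t i)).
    under [RHS]eq_bigr do rewrite mulr_sumr.
    rewrite exchange_big/=; apply: eq_bigr => j _.
    by rewrite /beta mulrAC mulr_sumr; apply: eq_bigr => i _; ring.
  apply: eq_bigr => i _; rewrite -blaschke_kernel//.
  by rewrite mulrAC mulrA.
have -> : \sum_(l < N) w l + \sum_(l < N) - (w l * kap l) / (x + kap l) =
    x * \sum_(j < N) beta j * malmquist kap j x.
  rewrite ew// mulr_sumr -big_split/=; apply: eq_bigr => l _.
  by field; rewrite gt_eqF ?addr_gt0.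
have sx : x * (Num.sqrt x)^-1 = Num.sqrt x.
  by rewrite -{1}(sqr_sqrtr (ltW x0)) expr2 mulfK// gt_eqF.
have s_le : x * s <= Num.sqrt x by rewrite -[leRHS]sx ler_pM2l// stle.
have s_ge : (1 - eta) * Num.sqrt x <= x * s.
  by rewrite -[X in _ * X]sx mulrCA ler_pM2l// stge.
have r_s : `|x * \sum_(j < N) beta j * malmquist kap j x - x * s| <= rho * Num.sqrt x.
  rewrite -mulrBr normrM (gtr0_norm x0) rE -sumrB.
  apply: (@le_trans _ _ (x * (rho * s))); last first.
    rewrite mulrCA ler_wpM2l//; exact: le_trans (phi_le _ xr).
  rewrite ler_pM2l// mulr_sumr (le_trans (ler_norm_sum _ _ _))//.
  apply: ler_sum => i _; have ti := t0 i.
  rewrite mulrBr mulr1 addrAC subrr add0r normrN normrM [leRHS]mulrC.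
  rewrite [`|nu / _|]ger0_norm; last by rewrite divr_ge0// ltW// addr_gt0.
  apply: ler_wpM2l; first by rewrite divr_ge0// ltW// addr_gt0.
  rewrite normrM (le_trans _ (phi_le _ xr))// ler_piMr//.
  by rewrite norm_blaschke_le1// ltW.
move: r_s; rewrite !ler_norml => /andP[r1 r2]; apply/andP; split; lra.
Qed.

Definition node (mu : R) (m k : nat) : R := mu * expR (k%:R / m%:R).

(** Fourth power of [e^(1/4) <= 4/3], which is the inverse of [e^(-1/4) >= 1 - 1/4]. The form of the
    right-hand side gives [sqrt e <= 16/9]. *)
Lemma expR1_le : expR 1 <= (16 / 9) ^+ 2 :> R.
Proof.
have e4 : 3 / 4 <= (expR (1 / 4))^-1 :> R.
  by rewrite -expRN (le_trans _ (expR_ge1Dx _))//; lra.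
have {}e4 : expR (1 / 4) <= 4 / 3 :> R.
  rewrite -[leLHS]invrK -[leRHS]invrK lef_pV2 ?posrE ?invr_gt0 ?expR_gt0//.
  by rewrite (_ : (4 / 3)^-1 = 3 / 4)//; field.
rewrite (_ : expR 1 = expR (1 / 4) ^+ 4 :> R).
  rewrite (_ : (16 / 9) ^+ 2 = (4 / 3) ^+ 4 :> R); last by field.
  by rewrite ler_pXn2r ?nnegrE ?expR_ge0// divr_ge0.
by rewrite -expRM_natl; congr expR; field.
Qed.

(** The worst case is [k = e x]; with [s = sqrt e] it asks for [(s^2 - 1) (s - 1) <= 2], which
    follows from [1 <= s <= 16/9]. *)
Lemma mobius_decay (x k : R) : 0 < x -> x <= k <= x * expR 1 ->
  `|(x - k) / (x + k)| <= expR (- 2^-1).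
Proof.
move=> x0 /andP[xk kx].
have k0 := lt_le_trans x0 xk.
have ex : expR (- 2^-1) = (expR (2^-1))^-1 :> R by rewrite expRN.
have e1 : expR 1 = expR (2^-1) ^+ 2 :> R.
  by rewrite -expRM_natl; congr expR; field.
have := expR1_le; move: kx; rewrite ex e1.
have := expR_gt0 (2^-1 : R); set s := expR _ => s0 kx.
rewrite ler_pXn2r ?nnegrE ?(ltW s0) ?divr_ge0// => s1.
rewrite normrM normfV [`|x + k|]gtr0_norm ?addr_gt0// ler0_norm ?subr_le0//.
rewrite ler_pdivrMr ?addr_gt0// ler_pdivlMl//.
have s2 : 1 <= s.
  by rewrite /s -[leLHS]expR0 ler_expR invr_ge0.
have : (k - x) * (s - 1) <= x * (s ^+ 2 - 1) * (s - 1).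
  by rewrite ler_wpM2r ?subr_ge0//; lra.
have : x * (s - 1) * (s ^+ 2 - 2 * s) <= 0.
  have : x * (s - 1) * (s * (2 - s)) >= 0.
    by rewrite !mulr_ge0 ?subr_ge0 ?(ltW x0) ?(ltW s0)//; lra.
  by nra.
nra.
Qed.

(** The last index over [m] is at most [ln (lambda / mu) + 1], so the nodes stop by [e lambda].
    Going [m] nodes past [lambda] serves the points [x] close to [lambda]. *)
Lemma node_range (mu lambda : R) (m k : nat) : 0 < mu -> mu <= lambda -> (0 < m)%N ->
  (k < Num.truncn (m%:R * ln (lambda / mu)) + m + 1)%N ->
  mu <= node mu m k <= 4 * lambda.
Proof.
move=> mu0 mul m0; rewrite addn1 ltnS => kK.
have m0' : 0 < m%:R :> R by rewrite ltr0n.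
have lm0 : 0 < lambda / mu by rewrite divr_gt0// (lt_le_trans mu0).
have l0 : 0 <= ln (lambda / mu) by rewrite ln_ge0// ler_pdivlMr// mul1r.
apply/andP; split.
  by rewrite ler_peMr ?(ltW mu0)// -[leLHS]expR0 ler_expR divr_ge0.
have kle : k%:R / m%:R <= ln (lambda / mu) + 1.
  rewrite ler_pdivrMr// mulrDl mul1r.
  apply: (@le_trans _ _ ((Num.truncn (m%:R * ln (lambda / mu)) + m)%:R)).
    by rewrite ler_nat.
  by rewrite natrD lerD2r mulrC truncn_le// mulr_ge0// ltW.
apply: (@le_trans _ _ (mu * expR (ln (lambda / mu) + 1))).
  by rewrite ler_pM2l// ler_expR.
rewrite expRD lnK ?posrE// [leLHS](_ : _ = expR 1 * lambda); last first.
  by rewrite mulrA mulrCA mulfV ?mulr1 1?mulrC// gt_eqF.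
rewrite ler_wpM2r//; first by rewrite ltW// (lt_le_trans mu0).
by apply: le_trans expR1_le _; lra.
Qed.

(** Consecutive nodes have ratio [e^(1/m) >= 1 + 1/m], so a gap is at least [1/(m+1)] of its larger
    node. *)
Lemma node_gap (mu : R) (m l k : nat) : 0 < mu -> (0 < m)%N -> (l < k)%N ->
  node mu m k <= m.+1%:R * (node mu m k - node mu m l).
Proof.
move=> mu0 m0 lk; have m0' : 0 < m%:R :> R by rewrite ltr0n.
rewrite /node -mulrBr mulrCA ler_pM2l//.
have : expR (k%:R / m%:R) >= expR (l%:R / m%:R) * expR (m%:R^-1) :> R.
  rewrite -expRD ler_expR -[X in _ + X]mul1r -mulrDl ler_pM2r ?invr_gt0//.
  by rewrite natr1 ler_nat.
have := expR_ge1Dx (m%:R^-1 : R); have := expR_gt0 (l%:R / m%:R : R).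
set a := expR _; set c := expR _; set b := expR _ => a0 c1 abc.
rewrite -natr1; have : (m%:R + 1) * a <= m%:R * b.
  apply: le_trans (_ : m%:R * (a * c) <= _); last by rewrite ler_pM2l.
  rewrite mulrCA -[leLHS]mulrC ler_pM2l//.
  apply: le_trans (_ : m%:R * (1 + m%:R^-1) <= _); last by rewrite ler_pM2l.
  by rewrite mulrDr mulr1 mulfV ?gt_eqF.
lra.
Qed.

(** Some [m] consecutive nodes lie in [[x, e x]] and contribute [e^(-1/2)] each; all other factors
    are at most 1 in absolute value. *)
Lemma blaschke_node_decay (mu lambda x : R) (m : nat) :
  0 < mu -> (0 < m)%N -> mu <= x <= lambda ->
  `|blaschke (node mu m) (Num.truncn (m%:R * ln (lambda / mu)) + m + 1) x|
    <= expR (- (m%:R / 2)).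
Proof.
move=> mu0 m0 /andP[mux xl]; have x0 := lt_le_trans mu0 mux.
have m0' : 0 < m%:R :> R by rewrite ltr0n.
have xm0 : 0 < x / mu by rewrite divr_gt0.
have l0 := lt_le_trans x0 xl.
have node0 k : 0 < node mu m k by rewrite mulr_gt0 ?expR_gt0.
(* Node [q] is the last one not exceeding [x]; the decaying factors are those of indices [q + 1] to
   [q + m]. *)
pose q := Num.truncn (m%:R * ln (x / mu)).
have lnx : 0 <= m%:R * ln (x / mu).
  by rewrite mulr_ge0 ?ln_ge0 ?ler_pdivlMr ?mul1r// ltW.
have qle : q%:R <= m%:R * ln (x / mu) by rewrite truncn_le.
have qgt : m%:R * ln (x / mu) < q.+1%:R by rewrite truncnS_gt.
have qK : (q <= Num.truncn (m%:R * ln (lambda / mu)))%N.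
  rewrite le_truncn// ler_wpM2l ?(ltW m0')// ler_ln ?posrE ?divr_gt0//.
  by rewrite ler_pM2r ?invr_gt0.
have xe : x = mu * expR (ln (x / mu)) by rewrite lnK ?posrE// mulrCA mulfV ?mulr1// gt_eqF.
have decay j : (j <= m)%N -> `|blaschke (node mu m) (q.+1 + j) x| <= expR (- 2^-1) ^+ j.
  elim: j => [_|j IHj jm]; first by rewrite expr0 norm_blaschke_le1 ?ltW.
  rewrite addnS blaschkeS normrM exprSr ler_pM ?IHj ?(ltnW jm)//.
  apply: mobius_decay => //; rewrite /node {1 2}xe -mulrA !ler_pM2l// -expRD !ler_expR.
  rewrite ler_pdivlMr// ler_pdivrMr//; apply/andP; split.
    by rewrite mulrC natrD (le_trans (ltW qgt))// lerDl.
  rewrite mulrDl mul1r [ln _ * _]mulrC addSnnS natrD lerD// ler_nat.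
  by [].
have mono i k : `|blaschke (node mu m) (k + i) x| <= `|blaschke (node mu m) k x|.
  elim: i => [|i IHi]; first by rewrite addn0.
  rewrite addnS blaschkeS normrM (le_trans _ IHi)// ler_piMr//.
  by rewrite norm_mobius_le1// ltW.
have -> : (Num.truncn (m%:R * ln (lambda / mu)) + m + 1 =
    (q.+1 + m) + (Num.truncn (m%:R * ln (lambda / mu)) - q))%N.
  by rewrite addn1 -addnA [(m + _)%N]addnC addnA addSn subnKC// addSn.
rewrite (le_trans (mono _ _))// (le_trans (decay _ (leqnn m)))//.
by rewrite -expRM_natl le_eqVlt mulrN mulrC eqxx.
Qed.

End Quadrature.

(** * Choice of the parameters and size of the weights *)

Section SqrtQuadrature.
Context {R : realType}.

Lemma ln_le_id (x : R) : 0 < x -> ln x <= x.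
Proof. by move=> /ln_sublinear/ltW. Qed.

(** The weights may be as large as [H^N], but only [ln eps'^-1] enters the running time, and
    [N ln H] is cubic in [ell]. For a fixed ratio [lambda / mu] the weight bound scales like
    [lambda^(3/2)] and the tolerance like [sqrt mu]; the remaining factor [lambda] produces
    [ln (Num.max 1 lambda)]. *)
Lemma sqrt_quadrature (mu lambda eps : R) :
  0 < mu -> mu <= lambda -> 0 < eps < 1 ->
  let ell := 1 + ln (lambda / mu) + ln eps^-1 in
  exists (N : nat) (w0 : R) (w kap : nat -> R) (eps' : R),
    [/\ (0 < N)%N /\ N%:R <= 19 * ell ^+ 2,
        forall k, (k < N)%N -> mu <= kap k <= 4 * lambda,
        forall x, mu <= x <= lambda ->
          `|w0 + \sum_(l < N) w l / (x + kap l) - Num.sqrt x|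
            <= eps / 2 * Num.sqrt x,
        0 < eps' < 1 /\ (\sum_(l < N) `|w l|) * eps' <= eps / 2 * Num.sqrt mu &
        ln eps'^-1 <= 1100 * ell ^+ 3 + ln (Num.max 1 lambda)].
Proof.
move=> mu0 mul /andP[eps0 eps1] ell.
have l0 := lt_le_trans mu0 mul.
have lm1 : 1 <= lambda / mu by rewrite ler_pdivlMr// mul1r.
have lm0 := lt_le_trans ltr01 lm1.
have lnlm : 0 <= ln (lambda / mu) by rewrite ln_ge0.
have ie1 : 1 <= eps^-1 by rewrite invf_ge1// ltW.
have lnie : 0 <= ln eps^-1 by rewrite ln_ge0.
have ell1 : 1 <= ell by rewrite /ell -addrA lerDl addr_ge0.
have ln4e : ln (4 / eps) <= 4 + ln eps^-1.
  by rewrite lnM ?posrE ?invr_gt0// lerD2r ln_le_id.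
have ln4e0 : 0 <= 2 * ln (4 / eps).
  by rewrite mulr_ge0// ln_ge0// (le_trans ie1)// ler_peMl ?(le_trans ler01)// ler1n.
(* The lower bound on [m] makes [e^(-m/2) <= eps / 4]; a quarter is also spent on [eta]. *)
have [m [m0 m_ge m_le]] : exists m : nat,
    [/\ (0 < m)%N, 2 * ln (4 / eps) <= m%:R & m%:R <= 9 * ell].
  exists (Num.truncn (2 * ln (4 / eps))).+1; split => //.
    by rewrite ltW// truncnS_gt.
  rewrite -natr1 /ell.
  have : (Num.truncn (2 * ln (4 / eps)))%:R <= 2 * ln (4 / eps) by rewrite truncn_le.
  by move: ((Num.truncn (2 * ln (4 / eps)))%:R : R) => t ?; lra.
have rho_le : expR (- (m%:R / 2)) <= eps / 4.
  rewrite -[leRHS]invrK invf_div -[4 / eps]lnK ?posrE ?divr_gt0// -expRN ler_expR.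
  by rewrite lerN2; lra.
have [N [N0 N_le nodes decay]] : exists N : nat,
    [/\ (0 < N)%N, N%:R <= 19 * ell ^+ 2,
        forall k, (k < N)%N -> mu <= node mu m k <= 4 * lambda &
        forall x, mu <= x <= lambda ->
          `|blaschke (node mu m) N x| <= expR (- (m%:R / 2))].
  exists (Num.truncn (m%:R * ln (lambda / mu)) + m + 1)%N; split.
  - by rewrite addn1.
  - have : m%:R * ln (lambda / mu) <= 9 * ell * ell.
      by apply: ler_pM => //; rewrite /ell; lra.
    have : (Num.truncn (m%:R * ln (lambda / mu)))%:R <= m%:R * ln (lambda / mu).
      by rewrite truncn_le// mulr_ge0.
    rewrite !natrD; move: ((Num.truncn (m%:R * ln (lambda / mu)))%:R : R) => t t1 t2.
    by nra.
  - by move=> k; exact: node_range.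
  - by move=> x; exact: blaschke_node_decay.
have N1 : 1 <= N%:R :> R by rewrite ler1n.
have [H [H1 H_le HE]] : exists H : R, [/\ 1 <= H, H <= 43 * ell & 3 + 4 * m.+1%:R = H].
  exists (3 + 4 * m.+1%:R); rewrite -natr1.
  by have : 0 <= m%:R :> R by []; split => //; lra.
have H0 := lt_le_trans ltr01 H1.
have [w0 [w [err wsum]]] : exists (w0 : R) (w : nat -> R),
    (forall x, mu <= x <= lambda ->
       `|w0 + \sum_(l < N) w l / (x + node mu m l) - Num.sqrt x|
         <= (eps / 4 + eps / 4) * Num.sqrt x) /\
    \sum_(l < N) `|w l| <=
      4 * lambda * (N%:R * (2 * Num.sqrt (4 * lambda) * (4 * lambda / mu) * H ^+ N)).
  rewrite -HE; apply: (@sqrt_fractions R (node mu m) N mu) => //.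
  - by rewrite ler1n.
  - by apply/andP; split; lra.
  - by move=> k; rewrite mulr_gt0 ?expR_gt0.
  - by move=> l k lk _; exact: node_gap.
  - by move=> x xr; rewrite (le_trans _ rho_le)// decay.
(* [Y], a multiple of [lambda * P], is the weight bound divided by the tolerance
   [eps / 2 * sqrt mu], after replacing [sqrt (4 lambda)] by the larger
   [sqrt mu * (4 lambda / mu)]. *)
pose P := eps^-1 * N%:R * (lambda / mu) ^+ 2 * H ^+ N.
have P1 : 1 <= P.
  apply: mulr_ege1; last exact: exprn_ege1.
  by apply: mulr_ege1; [exact: mulr_ege1|exact: exprn_ege1].
have P0 := lt_le_trans ltr01 P1.
have NR0 := lt_le_trans ltr01 N1.
pose Y := 256 * (lambda * P).
have Y0 : 0 < Y by apply: mulr_gt0; [rewrite ltr0n|exact: mulr_gt0].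
have Yw : \sum_(l < N) `|w l| <= eps / 2 * Num.sqrt mu * Y.
  apply: (le_trans wsum).
  have sq : Num.sqrt (4 * lambda) <= Num.sqrt mu * (4 * lambda / mu).
    have h1 : 1 <= 4 * lambda / mu by rewrite -mulrA; lra.
    have h0 := lt_le_trans ltr01 h1.
    rewrite -{1}[4 * lambda](divfK (lt0r_neq0 mu0)) mulrC sqrtrM ?(ltW mu0)//.
    rewrite ler_pM2l ?sqrtr_gt0// -[leRHS](ger0_norm (ltW h0)) -sqrtr_sqr.
    by rewrite ler_wsqrtr// expr2 ler_peMr// ltW.
  set s := Num.sqrt mu in sq *; set s' := Num.sqrt _ in sq *.
  rewrite [leRHS](_ : _ = 4 * lambda * (N%:R * (2 * (s * (4 * lambda / mu)) * (4 * lambda / mu) * H ^+ N))); last first.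
    rewrite /Y /P; move: (H ^+ N) (N%:R : R) => h k.
    by field; rewrite !gt_eqF.
  rewrite ler_pM2l ?mulr_gt0// ler_pM2l ?(lt_le_trans ltr01 N1)//.
  rewrite ler_pM2r ?exprn_gt0// ler_pM2r ?ler_pM2l//.
  by rewrite -mulrA mulr_gt0.
(* The summand 2 keeps [eps'] below 1 whatever the size of [Y]. *)
exists N, w0, w, (node mu m), (2 + Y)^-1; split.
- by [].
- by [].
- by move=> x xr; rewrite (_ : eps / 2 = eps / 4 + eps / 4)//; [exact: err|field].
- split.
    have Y2 : 1 < 2 + Y by rewrite ltr_pwDr// ler1n.
    by rewrite invr_gt0 invf_lt1 ?(lt_trans ltr01 Y2)// Y2.
  rewrite ler_pdivrMr ?addr_gt0// (le_trans Yw)// ler_wpM2l//; last by lra.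
  by rewrite mulr_ge0 ?sqrtr_ge0// divr_ge0// ltW.
rewrite invrK.
set mx := Num.max 1 lambda.
have mx1 : 1 <= mx by rewrite le_max lexx.
have lmx : lambda <= mx by rewrite le_max lexx orbT.
have mx0 := lt_le_trans ltr01 mx1.
have Yle : 2 + Y <= 258 * (mx * P).
  have : lambda * P <= mx * P by rewrite ler_pM2r.
  have : 1 <= mx * P by rewrite mulr_ege1.
  by rewrite /Y; move: (mx * P) (lambda * P) => a b; lra.
apply: (@le_trans _ _ (ln (258 * (mx * P)))).
  have c0 : 0 < 258 :> R by rewrite ltr0n.
  rewrite ler_ln ?posrE//; last by rewrite (mulr_gt0 c0)// mulr_gt0.
  by rewrite (addr_gt0 _ Y0).
have c0 : 0 < 258 :> R by rewrite ltr0n.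
have i0 : 0 < eps^-1 by rewrite invr_gt0.
have h0 := exprn_gt0 N H0; have l2 := exprn_gt0 2 lm0.
rewrite (lnM c0 (mulr_gt0 mx0 P0)) (lnM mx0 P0).
rewrite (lnM (mulr_gt0 (mulr_gt0 i0 NR0) l2) h0) (lnM (mulr_gt0 i0 NR0) l2) (lnM i0 NR0).
rewrite !lnXn// -[ln H *+ N]mulr_natl.
have ln258 : ln (258 : R) <= 258 by rewrite ln_le_id.
have lnN : ln (N%:R : R) <= N%:R by rewrite ln_le_id.
have NH : N%:R * ln H <= 817 * ell ^+ 3.
  apply: (@le_trans _ _ (19 * ell ^+ 2 * (43 * ell))); last by lra.
  apply: ler_pM => //; first by rewrite ln_ge0.
  by rewrite (le_trans _ H_le)// ln_le_id.
have ell2 : ell ^+ 2 <= ell ^+ 3 by rewrite ler_weXn2l.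
have ell3 : ell <= ell ^+ 2 by rewrite -[leLHS]expr1 ler_weXn2l.
have : ln eps^-1 + 2 * ln (lambda / mu) <= 2 * ell by rewrite /ell; lra.
lra.
Qed.
End SqrtQuadrature.

(** * The program *)

Section Program.
Context {R : realType}.

(** Integer variable 3 counts coordinates, integer variable 4 is the cursor in the table, and real
    array 3 accumulates the output. *)
Definition axpy_body (src : nat) : cmd R :=
  Seq (RPut 3 (IVar 3) (RAdd (RGet 3 (IVar 3))
                          (RMul (RGet 2 (IVar 4)) (RGet src (IVar 3)))))
      (ISet 3 (IAdd (IVar 3) (IConst 1))).

Definition axpy_loop (src : nat) : cmd R :=
  While (ILt (IVar 3) (IVar 0)) (axpy_body src).

Definition axpy (src : nat) : cmd R := Seq (ISet 3 (IConst 0)) (axpy_loop src).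

Definition next_entry : cmd R := ISet 4 (IAdd (IVar 4) (IConst 1)).

(** The cursor moves from a shift to its weight and on to the next shift. The query is always array
    0, which is never overwritten and so still holds the input vector. *)
Definition solve_step : cmd R :=
  Seq (Solve (RGet 2 (IVar 4)) (RGet 2 (IConst 0))
             (RMul (RVar 0) (RGet 2 (IConst 1))) 0 4)
      (Seq next_entry (Seq (axpy 4) next_entry)).

Definition solve_loop : cmd R := While (ILt (IVar 4) (IVar 2)) solve_step.

Definition sqrt_program : cmd R :=
  Seq (ISet 4 (IConst 2)) (Seq (axpy 0) (Seq next_entry solve_loop)).

Context {n : nat} {Omega : Type}.
Context (S : solver R n Omega) (seed : nat -> Omega) (coin : nat -> bool).

Lemma array_of_vecE (v : 'cV[R]_n) (i : 'I_n) : array_of_vec v i = v i 0.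
Proof. by rewrite /array_of_vec valK. Qed.

(** Induction on the number [k] of remaining coordinates. A pass costs 3 for the test, 10 for the
    update and 4 for the increment; the failing test adds 3. *)
Lemma axpy_loop_exec (src k : nat) (s : state R) : src != 3%N ->
  ivar s 0 = n -> (ivar s 3 + k)%N = n ->
  exists s', [/\ exec S seed coin (axpy_loop src) s s',
    forall x, x != 3%N -> ivar s' x = ivar s x,
    (rvar s' = rvar s) /\ (draws s' = draws s),
    forall a, a != 3%N -> rarr s' a = rarr s a &
    (forall i, rarr s' 3 i = if (ivar s 3 <= i < n)%N
       then rarr s 3 i + rarr s 2 (ivar s 4) * rarr s src i else rarr s 3 i) /\
    clock s' = clock s + (17 * k + 3)%:R].
Proof.
move=> src3; elim: k s => [|k IHk] s n0 ik.
  exists (tick s 3%:R); split => //.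
    by apply: ExecWhileStop; rewrite /= n0 -ik addn0 ltnn.
  by split=> // i; rewrite -ik addn0 leqNgt andNb.
have lt_in : (ivar s 3 < n)%N by rewrite -ik addnS ltnS leq_addr.
have [||s' [ex iv [rv dr] ra [ra3 cl]]] := IHk (tick (set_ivar
    (tick (set_rarr (tick s 3%:R) 3 (ivar s 3) (rarr s 3 (ivar s 3) +
       rarr s 2 (ivar s 4) * rarr s src (ivar s 3))) 10%:R)
    3 (ivar s 3 + 1)%N) 4%:R).
- by rewrite /= /upd.
- by rewrite /= /upd/= addn1 addSnnS.
exists s'; split => //.
- apply: (@ExecWhileStep _ _ _ _ _ _ _ _ _ _ _ _ _ ex); first by rewrite /= n0.
  by apply: ExecSeq; [exact: ExecRPut|exact: ExecISet].
- by move=> x x3; rewrite iv//= /upd (negbTE x3).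
- by move=> a a3; rewrite ra//= /upd (negbTE a3).
split; last by rewrite cl mulnS !(natrM, natrD) /=; ring.
move=> i; rewrite ra3/= /upd/= (negbTE src3) addn1.
case: (ltngtP i (ivar s 3)) => [//|//|->].
by rewrite lt_in.
Qed.

Lemma axpy_exec (src : nat) (s : state R) : src != 3%N -> ivar s 0 = n ->
  exists s', [/\ exec S seed coin (axpy src) s s',
    forall x, x != 3%N -> ivar s' x = ivar s x,
    (rvar s' = rvar s) /\ (draws s' = draws s),
    forall a, a != 3%N -> rarr s' a = rarr s a &
    read_vec n s' 3 = read_vec n s 3 + rarr s 2 (ivar s 4) *: read_vec n s src /\
    clock s' = clock s + (17 * n + 5)%:R].
Proof.
move=> src3 n0.
have [//||s' [ex iv [rv dr] ra [ra3 cl]]] :=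
  @axpy_loop_exec src n (tick (set_ivar s 3 0) 2%:R) src3.
  by rewrite /= /upd.
exists s'; split => //.
- by apply: ExecSeq ex; exact: ExecISet.
- by move=> x x3; rewrite iv//= /upd (negbTE x3).
split; last by rewrite cl !(natrM, natrD) /=; ring.
by apply/colP => i; rewrite !mxE ra3/= /upd/= ltn_ord.
Qed.

Variables (v : 'cV[R]_n) (N : nat) (delta D : R) (tab : nat -> R).
Hypothesis duration_le : forall l, (l < N)%N ->
  duration S (seed l) (tab (3 + 2 * l)%N) (tab 0%N) (delta * tab 1%N) v <= D.

Definition solve_answer (l : nat) : 'cV[R]_n :=
  answer S (seed l) (tab (3 + 2 * l)%N) (tab 0%N) (delta * tab 1%N) v.

(** Before pass [l] exactly [l] draws have been made, so call [l] consumes seed [l]. Besides the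
    duration of the solver, a pass costs 3 for the test, [n + 9] for the call, [17 n + 5] for the
    update and 4 for each of two cursor moves. *)
Lemma solve_loop_exec (r l : nat) (s : state R) : (l + r)%N = N ->
  ivar s 0 = n -> ivar s 2 = (3 + 2 * N)%N -> ivar s 4 = (3 + 2 * l)%N ->
  rvar s 0 = delta -> rarr s 0 = array_of_vec v -> rarr s 2 = tab ->
  draws s = l ->
  exists s', [/\ exec S seed coin solve_loop s s',
    read_vec n s' 3 = read_vec n s 3
      + \sum_(l <= j < N) tab (4 + 2 * j)%N *: solve_answer j &
    clock s' <= clock s + r%:R * ((18 * n + 25)%:R + D) + 3].
Proof.
elim: r l s => [|r IHr] l s lr n0 sz p rv ra0 ra2 dr.
  exists (tick s 3%:R); split => //.
  - by apply: ExecWhileStop; rewrite /= sz p -lr addn0 ltnn.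
  - by rewrite -lr addn0 big_geq ?addr0//; apply/colP=> i; rewrite !mxE.
  - by rewrite /= mul0r addr0.
have lN : (l < N)%N by rewrite -lr addnS ltnS leq_addr.
have ra0v (s1 : state R) : rarr s1 0 = array_of_vec v -> read_vec n s1 0 = v.
  by move=> e; apply/colP=> i; rewrite mxE e array_of_vecE.
pose s0 := tick s 3%:R.
have ex1 := @ExecSolve R n Omega S seed coin s0 (RGet 2 (IVar 4)) (RGet 2 (IConst 0))
  (RMul (RVar 0) (RGet 2 (IConst 1))) 0 4.
rewrite /= p dr rv ra2 (ra0v s0 ra0) -/(solve_answer l) in ex1.
move: ex1; set s1 := tick (next_draw _) _ => ex1.
pose s2 := tick (set_ivar s1 4 (4 + 2 * l)%N) 4%:R.
have ex2 : exec S seed coin next_entry s1 s2.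
  have := @ExecISet R n Omega S seed coin s1 4 (IAdd (IVar 4) (IConst 1)).
  by rewrite /= p /s2 addn1.
have [||s3 [ex3 iv3 [rv3 dr3] ra3 [vec3 cl3]]] := @axpy_exec 4 s2.
- by [].
- exact: n0.
pose s4 := tick (set_ivar s3 4 (3 + 2 * l.+1)%N) 4%:R.
have ex4 : exec S seed coin next_entry s3 s4.
  have := @ExecISet R n Omega S seed coin s3 4 (IAdd (IVar 4) (IConst 1)).
  have e : (4 + 2 * l + 1 = 3 + 2 * l.+1)%N by rewrite mulnS addn1.
  by rewrite /= iv3//= e.
have [||||||||s5 [ex5 vec5 cl5]] := IHr l.+1 s4.
- by rewrite addSnnS.
- by rewrite /= /upd/= iv3.
- by rewrite /= /upd/= iv3.
- by rewrite /= /upd.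
- by rewrite /= rv3.
- by rewrite /= ra3.
- by rewrite /= ra3.
- by rewrite /= dr3 /= dr.
exists s5; split.
- apply: (@ExecWhileStep _ _ _ _ _ _ _ _ s s4 s5 _ _ ex5).
    by rewrite /= sz p ltn_add2l ltn_pmul2l.
  by apply: ExecSeq ex1 _; apply: ExecSeq ex2 _; exact: ExecSeq ex3 ex4.
- rewrite vec5 [in RHS]big_ltn// addrA; congr (_ + _).
  rewrite (_ : read_vec n s4 3 = read_vec n s3 3); last by apply/colP=> i; rewrite !mxE.
  rewrite vec3; congr (_ + _).
  rewrite /= /upd/= ra2; congr (_ *: _).
  by apply/colP=> i; rewrite mxE/= /upd/= array_of_vecE.
apply: (le_trans cl5); rewrite /= cl3 /= lerD2r.
have := duration_le lN.
rewrite (_ : (2 + 2 + (1 + 2).+1 + n).+1 = (9 + n)%N)//.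
rewrite -[r.+1%:R]natr1 mulrDl mul1r !(natrM, natrD); lra.
Qed.

Lemma sqrt_program_exec (s : state R) :
  ivar s 0 = n -> ivar s 2 = (3 + 2 * N)%N -> rvar s 0 = delta ->
  rarr s 0 = array_of_vec v -> rarr s 2 = tab -> rarr s 3 = (fun=> 0) ->
  draws s = 0%N -> clock s = 0 ->
  exists s', [/\ exec S seed coin sqrt_program s s',
    read_vec n s' 3 = tab 2%N *: v
      + \sum_(j < N) tab (4 + 2 * j)%N *: solve_answer j &
    clock s' <= (17 * n + 14)%:R + N%:R * ((18 * n + 25)%:R + D)].
Proof.
move=> n0 sz rv ra0 ra2 ra3 dr cl.
pose s1 := tick (set_ivar s 4 2) 2%:R.
have [||s2 [ex2 iv2 [rv2 dr2] ra2' [vec2 cl2]]] := @axpy_exec 0 s1.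
- by [].
- exact: n0.
pose s3 := tick (set_ivar s2 4 3) 4%:R.
have ex3 : exec S seed coin next_entry s2 s3.
  have := @ExecISet R n Omega S seed coin s2 4 (IAdd (IVar 4) (IConst 1)).
  by rewrite /= iv2.
have [||||||||s4 [ex4 vec4 cl4]] := @solve_loop_exec N 0 s3.
- by [].
- by rewrite /= /upd/= iv2.
- by rewrite /= /upd/= iv2.
- by rewrite /= /upd.
- by rewrite /= rv2.
- by rewrite /= ra2'.
- by rewrite /= ra2'.
- by rewrite /= dr2.
exists s4; split.
- apply: (@ExecSeq _ _ _ _ _ _ _ _ s s1); first exact: ExecISet.
  by apply: ExecSeq ex2 _; exact: ExecSeq ex3 ex4.
- rewrite vec4 big_mkord; congr (_ + _).
  rewrite (_ : read_vec n s3 3 = read_vec n s2 3); last by apply/colP=> i; rewrite !mxE.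
  rewrite vec2 /= /upd/= ra2 (_ : read_vec n s1 3 = 0) ?add0r.
    by congr (_ *: _); apply/colP=> i; rewrite mxE/= ra0 array_of_vecE.
  by apply/colP=> i; rewrite !mxE/= ra3.
apply: (le_trans cl4); rewrite /= cl2 /= cl !(natrM, natrD); lra.
Qed.

End Program.

(** * Encoding of the quadrature as a table of constants *)

Section Table.
Context {R : realType}.

(* The layout read by sqrt_program: the solver accuracy, the factor turning
   delta into the failure probability of one call, the weight of v itself, and
   then the shifts and weights in alternation. *)
Definition quadrature_table (N : nat) (w0 : R) (w kap : nat -> R) (eps' : R) :
    seq R :=
  mkseq (fun j => match j with
    | 0 => eps'
    | 1 => N%:R^-1
    | 2 => w0
    | j'.+3 => if odd j' then w j'./2 else kap j'./2
    end) (3 + 2 * N).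

Lemma nth_quadrature_shift N w0 w kap eps' l : (l < N)%N ->
  nth 0 (quadrature_table N w0 w kap eps') (3 + 2 * l) = kap l.
Proof.
move=> lN; rewrite nth_mkseq ?ltn_add2l ?ltn_pmul2l//.
by rewrite -[(3 + 2 * l)%N]/((2 * l).+3) mul2n odd_double doubleK.
Qed.

Lemma nth_quadrature_weight N w0 w kap eps' l : (l < N)%N ->
  nth 0 (quadrature_table N w0 w kap eps') (4 + 2 * l) = w l.
Proof.
move=> lN; rewrite nth_mkseq; last first.
  by rewrite -[4%N]/(3 + 1)%N -addnA ltn_add2l !mul2n add1n ltn_Sdouble.
by rewrite -[(4 + 2 * l)%N]/((2 * l).+4) mul2n/= odd_double uphalf_double.
Qed.

End Table.

(** * Joint success of independent solver calls *)

Section Probability.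
Context {R : realType}.

(** Bernoulli's inequality; the induction step is [(1 - r) (1 - s) >= 0], after showing that the
    partial products are real numbers. *)
Lemma prod_ge_union_bound (q : nat -> \bar R) (delta' : R) (m : nat) :
  (forall i, (i < m)%N -> ((1 - delta')%:E <= q i <= 1)%E) -> 0 <= delta' <= 1 ->
  ((1 - m%:R * delta')%:E <= \big[*%E/1%E]_(i < m) q i)%E.
Proof.
move=> qP /andP[d0 d1].
suff [r [-> /andP[_ r1] r2]] : exists r : R,
    [/\ \big[*%E/1%E]_(i < m) q i = r%:E, 0 <= r <= 1 & 1 - m%:R * delta' <= r].
  by rewrite lee_fin.
elim: m qP => [|m IHm] qP.
  by exists 1; rewrite big_ord0 mul0r subr0 lexx ler01.
have [r [e /andP[r0 r1] r2]] := IHm (fun i im => qP i (ltnW im)).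
have /andP[] := qP m (ltnSn m).
case em : (q m) => [s| |]//; rewrite !lee_fin => s0 s1.
exists (r * s); rewrite big_ord_recr/= e em; split => //.
  by rewrite mulr_ge0 ?mulr_ile1//; lra.
have : 0 <= (1 - r) * (1 - s) by rewrite mulr_ge0//; lra.
by rewrite -natr1; lra.
Qed.

(** The sets [good i] are fixed in advance, so independence of the seeds turns joint success into a
    product; the coins are left unconstrained. *)
Lemma random_tape_joint {d d' : measure_display} {Omega : measurableType d}
    {W : measurableType d'} (Q : probability Omega R) (P : probability W R)
    (seed : nat -> W -> Omega) (coin : nat -> W -> bool)
    (N : nat) (delta' : R) (good : nat -> set Omega) :
  random_tape Q P seed coin -> 0 <= delta' <= 1 ->
  (forall i, (i < N)%N -> with_prob_ge Q (1 - delta') (good i)) ->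
  with_prob_ge P (1 - N%:R * delta')
    [set w | forall i, (i < N)%N -> good i (seed i w)]%classic.
Proof.
move=> [mseed mcoin joint] d01 hgood.
(* Measurable subsets stand in for the sets [good i]; from index [N] on, the full set is a
   default. *)
have /choice[E EP] : forall i, exists E : set Omega, measurable E /\
    ((i < N)%N -> (E `<=` good i)%classic /\ ((1 - delta')%:E <= Q E)%E).
  move=> i; have [iN|_] := ltnP i N; last by exists setT; split.
  by have [E [mE Eg QE]] := hgood i iN; exists E.
have mE i : measurable (E i) by have [] := EP i.
exists (\bigcap_(i in [set j | (j < N)%N])
   (seed i @^-1` E i `&` coin i @^-1` setT))%classic; split.
- apply: bigcap_measurableType => i _; apply: measurableI; last first.
    by rewrite preimage_setT.
  by rewrite -[X in measurable X]setTI; exact: mseed.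
- move=> w Ew i iN; have [] := Ew i iN => ? _.
  by have [_ /(_ iN)[+ _]] := EP i; apply.
rewrite (joint N E (fun=> setT))//.
apply: (@prod_ge_union_bound
  (fun i => Q (E i) * bernoulli_prob (2^-1 : R) setT)%E) => // i iN.
rewrite probability_setT mule1 probability_le1// andbT.
by have [_ /(_ iN)[]] := EP i.
Qed.

End Probability.

(** Here [x] is [n], [z] is [nnz M], [N] the number of calls, [E] the logarithmic factor of one call
    and [l] is [ln (Num.max 1 lambda)]. The sum bounding [E] is at most the product [c L^3 (1 + l)],
    whose powers separate. *)
Lemma solver_time_le {R : realType} (c x z N L T l E : R) (a : nat) :
  1 <= c -> 1 <= x -> x <= z -> 1 <= N -> N <= 19 * L ^+ 2 -> 1 <= L ->
  0 <= T -> 0 <= l -> 0 <= E -> E <= c * L ^+ 3 + l ->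
  17 * x + 14 + N * (18 * x + 25 + T * E ^+ a) <=
  1406 * c ^+ a * L ^+ (2 + 3 * a) * (z + T * (1 + l) ^+ a).
Proof.
move=> c1 x1 xz N1 NL L1 T0 l0 E0 Ec.
have L3 : 1 <= L ^+ 3 by rewrite exprn_ege1.
have c0 : 0 < c by apply: lt_le_trans c1.
have cL : 1 <= c * L ^+ 3 by rewrite mulr_ege1.
have El : E ^+ a <= (c * L ^+ 3) ^+ a * (1 + l) ^+ a.
  have EL : E <= c * L ^+ 3 * (1 + l).
    by rewrite (le_trans Ec)// mulrDr mulr1 lerD2l ler_peMl.
  by rewrite -exprMn; apply: lerXn2r; rewrite ?nnegrE ?(le_trans E0 EL).
rewrite exprD exprM.
rewrite exprMn in El.
have ca : 1 <= c ^+ a by rewrite exprn_ege1.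
have La : 1 <= (L ^+ 3) ^+ a by rewrite exprn_ege1.
have cLa : 1 <= c ^+ a * (L ^+ 3) ^+ a by rewrite mulr_ege1.
have l1 : 0 <= (1 + l) ^+ a by rewrite exprn_ge0// addr_ge0.
rewrite [leRHS](_ : _ = 1406 * (L ^+ 2 * ((c ^+ a * (L ^+ 3) ^+ a) * z
    + T * (c ^+ a * (L ^+ 3) ^+ a * (1 + l) ^+ a)))); last by ring.
move: El cLa; set e := E ^+ a; set f := c ^+ a * _; set g := (1 + l) ^+ a => El cLa.
have TE : T * e <= T * (f * g) by rewrite ler_wpM2l.
have zf : z <= f * z by rewrite ler_peMl//; lra.
have TE0 : 0 <= T * e by rewrite mulr_ge0 ?exprn_ge0.
have S1 : 0 <= f * z + T * (f * g) by lra.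
(* The fixed cost is at most [31 x], and [31 + 18 + 25 = 74]; finally [1406 = 19 * 74]. *)
apply: (@le_trans _ _ (N * (74 * (f * z + T * (f * g))))).
  apply: (@le_trans _ _ (N * (35 * x - 4 * x + (18 * x + 25 + T * e)))).
    rewrite [leRHS]mulrDr lerD2r.
    apply: (@le_trans _ _ (1 * (35 * x - 4 * x))); first by lra.
    by rewrite ler_wpM2r//; lra.
  by rewrite ler_pM2l; lra.
rewrite [leRHS](_ : _ = 19 * L ^+ 2 * (74 * (f * z + T * (f * g)))); last by ring.
by rewrite ler_wpM2r//; lra.
Qed.

(** * Approximation error plus solver error *)

Section ErrorSplit.
Context {R : realType} {n : nat}.

(** Half of [eps] pays for the rational approximation, the other half for the inexact answers, whose
    weighted errors are compared with the output by [l2norm_sqrtmx_ge]. *)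
Lemma sqrt_output_error (M : 'M[R]_n) (mu lambda eps eps' w0 : R) (N : nat)
    (w kap : nat -> R) (ans : nat -> 'cV[R]_n) (v : 'cV[R]_n) :
  0 < mu -> 0 < eps -> psd_mx M -> loewner_le mu%:M M -> loewner_le M lambda%:M ->
  (forall l, (l < N)%N -> 0 < kap l) ->
  (forall x, mu <= x <= lambda ->
     `|w0 + \sum_(l < N) w l / (x + kap l) - Num.sqrt x| <= eps / 2 * Num.sqrt x) ->
  (\sum_(l < N) `|w l|) * eps' <= eps / 2 * Num.sqrt mu ->
  (forall l, (l < N)%N ->
     l2norm (ans l - invmx (M + (kap l)%:M) *m v) <= eps' * l2norm v) ->
  l2norm (w0 *: v + \sum_(l < N) w l *: ans l - sqrtmx M *m v)
    <= eps * l2norm (sqrtmx M *m v).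
Proof.
move=> mu0 eps0 pM muM Ml kap0 happ wsum hans.
set exact_part := w0 *: v + \sum_(l < N) w l *: (invmx (M + (kap l)%:M) *m v)
  - sqrtmx M *m v.
rewrite (_ : _ - _ = exact_part
    + \sum_(l < N) w l *: (ans l - invmx (M + (kap l)%:M) *m v)); last first.
  under [X in _ = _ + X]eq_bigr do rewrite scalerBr.
  rewrite sumrB /exact_part; move: (\sum_(l < N) _) (\sum_(l < N) _) => A B.
  by apply/colP=> i; rewrite !mxE; ring.
rewrite (le_trans (ler_l2normD _ _))// [eps]splitr mulrDl lerD//.
  have e2 : 0 <= eps / 2 by rewrite divr_ge0// ltW.
  have err := rational_sqrt_error pM muM Ml v e2 kap0 happ.
  by rewrite /exact_part.
rewrite (le_trans (ler_l2norm_sum N (fun l => w l *: (ans l - invmx (M + (kap l)%:M) *m v))))//.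
apply: (@le_trans _ _ (\sum_(l < N) `|w l| * (eps' * l2norm v))).
  by apply: ler_sum => l _; rewrite l2normZ ler_wpM2l ?hans.
rewrite -mulr_suml mulrA.
apply: (@le_trans _ _ (eps / 2 * Num.sqrt mu * l2norm v)).
  by rewrite ler_wpM2r ?l2norm_ge0.
rewrite -mulrA ler_wpM2l ?divr_ge0 ?(ltW eps0)//.
exact: l2norm_sqrtmx_ge.
Qed.

End ErrorSplit.

(** * Correctness, running time and failure probability of the program *)

Theorem theorem4 (R : realType) :
  exists (p : cmd R) (table : R -> R -> R -> seq R) (c : R) (b : nat),
    0 < c /\
  forall a : nat, exists (C : R) (k : nat),
  forall (n : nat) (M : 'M[R]_n) (mu lambda eps delta : R),
    (0 < n)%N -> 0 < mu -> mu <= lambda ->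
    0 < eps < 1 -> 0 < delta < 1 ->
    psd_mx M -> loewner_le mu%:M M -> loewner_le M lambda%:M ->
    let L := logs n mu lambda eps delta in
  forall (d : measure_display) (Omega : measurableType d)
    (Q : probability Omega R) (S : solver R n Omega) (T : R),
    0 <= T ->
    solves_shifted Q S M (mu / (c * L ^+ b)) (c * L ^+ b * lambda) T a ->
  forall (d' : measure_display) (W : measurableType d') (P : probability W R)
    (seed : nat -> W -> Omega) (coin : nat -> W -> bool),
    random_tape Q P seed coin ->
  exists (out : 'cV[R]_n -> W -> 'cV[R]_n) (time : 'cV[R]_n -> W -> R),
    [/\ forall v w,
          halts_with S (seed ^~ w) (coin ^~ w) p
            (init_state M v delta (table mu lambda eps)) (out v w) (time v w),
        forall v w,
          time v w <= C * L ^+ k *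
            ((nnz M)%:R + T * (1 + ln (Num.max 1 lambda)) ^+ a) &
        approx_sqrt_solver P M eps delta out].
Proof.
(* The table must be a function of all real triples; it is empty for inadmissible ones. *)
have tableP (x : R * R * R) : exists t : seq R,
    0 < x.1.1 -> x.1.1 <= x.1.2 -> 0 < x.2 < 1 ->
    let ell := 1 + ln (x.1.2 / x.1.1) + ln x.2^-1 in
    exists (N : nat) (w0 : R) (w kap : nat -> R) (eps' : R),
    t = quadrature_table N w0 w kap eps' /\
    [/\ (0 < N)%N /\ N%:R <= 19 * ell ^+ 2,
        forall k, (k < N)%N -> x.1.1 <= kap k <= 4 * x.1.2,
        forall y, x.1.1 <= y <= x.1.2 ->
          `|w0 + \sum_(l < N) w l / (y + kap l) - Num.sqrt y|
            <= x.2 / 2 * Num.sqrt y,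
        0 < eps' < 1 /\
          (\sum_(l < N) `|w l|) * eps' <= x.2 / 2 * Num.sqrt x.1.1 &
        ln eps'^-1 <= 1100 * ell ^+ 3 + ln (Num.max 1 x.1.2)].
  case: (pselect [/\ 0 < x.1.1, x.1.1 <= x.1.2 & 0 < x.2 < 1]); last first.
    by move=> nx; exists [::] => ? ? ?; case: nx.
  move=> [x0 x1 x2]; have [N [w0 [w [kap [eps' H]]]]] := sqrt_quadrature x0 x1 x2.
  exists (quadrature_table N w0 w kap eps') => _ _ _ ell.
  by exists N, w0, w, kap, eps'.
have {tableP}[tbl tblP] := choice tableP.
(* All shifts lie in [[mu, 4 lambda]], so the range needs a constant but no logarithmic factor. *)
exists (sqrt_program : cmd R), (fun mu lambda eps => tbl (mu, lambda, eps)), 4, 0%N.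
split=> [|a]; first by [].
(* [1121 = 1 + 1100 + 1 + 19]: the constant term, [ln eps'^-1], [ln delta^-1] and [ln N], each
   compared with [L^3]. *)
exists (1406 * 1121 ^+ a), (2 + 3 * a)%N.
move=> n M mu lambda eps delta n0 mu0 mul eps01 delta01 pM muM Ml L d Omega Q S T
  T0 hS d' W P seed coin tape.
have [N [w0 [w [kap [eps' [tE [[N0 Nle] kapP happ [eps'01 wsum] lneps']]]]]]] :=
  tblP (mu, lambda, eps) mu0 mul eps01.
move: tE Nle kapP happ wsum lneps' => /= tE Nle kapP happ wsum lneps'.
set table := tbl _ in tE *.
set ell := (1 + ln (lambda / mu) + ln eps^-1 : R) in Nle lneps'.
have /andP[eps0 eps1] := eps01; have /andP[delta0 delta1] := delta01.
have /andP[eps'0 eps'1] := eps'01.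
have N1 : 1 <= N%:R :> R by rewrite ler1n.
have NR0 := lt_le_trans ltr01 N1.
have n1 : 1 <= n%:R :> R by rewrite ler1n.
have lm1 : 1 <= lambda / mu by rewrite ler_pdivlMr// mul1r.
have lnlm : 0 <= ln (lambda / mu) by rewrite ln_ge0.
have lne : 0 <= ln eps^-1 by rewrite ln_ge0// invf_ge1// ltW.
have lnd : 0 <= ln delta^-1 by rewrite ln_ge0// invf_ge1// ltW.
have lnn : 0 <= ln (n%:R : R) by rewrite ln_ge0.
have ell1 : 1 <= ell by rewrite /ell; lra.
have ellL : ell <= L by rewrite /ell /L /logs; lra.
have deltaL : ln delta^-1 <= L by rewrite /L /logs; lra.
have L1 : 1 <= L by apply: le_trans ellL.
(* Each of the [N] calls gets an equal share of the failure probability. *)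
pose delta' := delta * N%:R^-1.
have delta'0 : 0 < delta' by rewrite mulr_gt0// invr_gt0.
have delta'1 : delta' < 1.
  by rewrite ltr_pdivrMr// mul1r (lt_le_trans delta1).
have delta'01 : 0 < delta' < 1 by rewrite delta'0.
have kap_in l : (l < N)%N ->
    mu / (4 * L ^+ 0) <= kap l <= 4 * L ^+ 0 * lambda.
  move=> /kapP /andP[k1 k2]; rewrite expr0 !mulr1 k2 andbT (le_trans _ k1)//.
  by rewrite ler_pdivrMr// ler_peMr ?(ltW mu0)// ler1n.
pose tab := nth 0 table.
have tab0 : tab 0%N = eps' by rewrite /tab tE.
have tab1 : tab 1%N = N%:R^-1 by rewrite /tab tE.
have tab2 : tab 2%N = w0 by rewrite /tab tE.
have tab3 l : (l < N)%N -> tab (3 + 2 * l)%N = kap l.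
  by move=> lN; rewrite /tab tE nth_quadrature_shift.
have tab4 l : (l < N)%N -> tab (4 + 2 * l)%N = w l.
  by move=> lN; rewrite /tab tE nth_quadrature_weight.
pose D := T * (1 + ln eps'^-1 + ln delta'^-1) ^+ a.
pose ans v x l := solve_answer S (seed ^~ x) v delta tab l.
pose out v x := w0 *: v + \sum_(l < N) w l *: ans v x l.
have run (vx : 'cV[R]_n * W) : exists t : R,
    halts_with S (seed ^~ vx.2) (coin ^~ vx.2) sqrt_program
      (init_state M vx.1 delta table) (out vx.1 vx.2) t /\
    t <= (17 * n + 14)%:R + N%:R * ((18 * n + 25)%:R + D).
  case: vx => v x /=.
  have dur l : (l < N)%N ->
      duration S (seed l x) (tab (3 + 2 * l)%N) (tab 0%N) (delta * tab 1%N) v <= D.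
    move=> lN; rewrite tab0 tab1 tab3//.
    by have [_ /(_ (seed l x))/andP[]] := hS _ _ _ v (kap_in l lN) eps'01 delta'01.
  have [||||||||s [ex vec cl]] := @sqrt_program_exec R n Omega S (seed ^~ x)
    (coin ^~ x) v N delta D tab dur (init_state M v delta table).
  - by [].
  - by rewrite /= tE size_mkseq.
  - by [].
  - by [].
  - by [].
  - by apply/funext => i /=; rewrite nth_nil.
  - by [].
  - by [].
  exists (clock s); split => //; exists s; split => //.
  rewrite vec tab2; congr (_ + _); apply: eq_bigr => l _.
  by rewrite tab4.
have [time timeP] := choice run.
exists out, (fun v x => time (v, x)); split.
- by move=> v x; have [] := timeP (v, x).
- move=> v x; have [_ tle] := timeP (v, x); apply: (le_trans tle).
  rewrite !(natrD, natrM); apply: solver_time_le => //.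
  + by rewrite ler1n.
  + by rewrite ler_nat (nnz_ge mu0 muM).
  + rewrite (le_trans Nle)// ler_pM2l// ler_pXn2r// ?nnegrE ?(le_trans ler01)//.
  + by rewrite ln_ge0// le_max lexx.
  + rewrite addr_ge0 ?addr_ge0 ?ln_ge0 ?invf_ge1 ?(ltW eps'1) ?(ltW delta'1)//.
  + have -> : ln delta'^-1 = ln delta^-1 + ln (N%:R : R).
      by rewrite /delta' invfM invrK lnM ?posrE ?invr_gt0.
    have lnN : ln (N%:R : R) <= 19 * ell ^+ 2 by rewrite (le_trans _ Nle)// ln_le_id.
    have e3 : ell ^+ 3 <= L ^+ 3.
      by rewrite ler_pXn2r ?nnegrE ?(le_trans ler01).
    have e2 : ell ^+ 2 <= ell ^+ 3 by rewrite ler_weXn2l.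
    have e1 : L <= L ^+ 3 by rewrite -[leLHS]expr1 ler_weXn2l.
    lra.
move=> v.
(* For fixed [v] these events depend on [l] and on one seed only, not on earlier answers. *)
have joint := random_tape_joint (N := N) (delta' := delta')
  (good := fun l => [set x | l2norm (answer S x (kap l) eps' delta' v
     - invmx (M + (kap l)%:M) *m v) <= eps' * l2norm v]%classic) tape.
have [||E [mE Egood PE]] := joint.
- by rewrite (ltW delta'0) (ltW delta'1).
- by move=> l lN; have [] := hS _ _ _ v (kap_in l lN) eps'01 delta'01.
exists E; split => //; last first.
  move: PE; rewrite (_ : N%:R * delta' = delta)//.
  by rewrite /delta' mulrCA mulfV ?mulr1// gt_eqF.
move=> x /Egood /= hx.
apply: (sqrt_output_error mu0 eps0 pM muM Ml (kap := kap) (eps' := eps') _ happ wsum).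
  by move=> l lN; have /andP[+ _] := kapP l lN; exact: lt_le_trans.
move=> l lN; rewrite /ans /solve_answer tab0 tab1 tab3//.
exact: hx.
Qed.
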